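(* Let $G$ be a bicyclic graph with minimum degree $\delta(G)=1$. Then $G$ has exactly two main signless Laplacian eigenvalues if and only if $G$ is isomorphic to a graph $H$ of the following form, for some integer $k\geq 2$: take two distinct vertices $u,v$; join them by three internally vertex-disjoint paths, namely two paths $u\,p\,v$ and $u\,q\,v$ of length $2$, and one path $u\,x_1x_2\cdots x_{k-1}\,v$ of length $k$; finally attach exactly one new pendant vertex $y_i$ (adjacent only to $x_i$) to each internal vertex $x_i$, $1\le i\le k-1$, of the path of length $k$.
   Context: All graphs are finite, simple and connected. A bicyclic graph is a simple connected graph whose number of edges equals its number of vertices plus one. For a graph $G$ with degree matrix $D=\mathrm{diag}(d(v_1),\dots,d(v_n))$ and adjacency matrix $A$, the signless Laplacian is $L^+=D+A$. An eigenvalue $\mu$ of $L^+$ is a main signless Laplacian eigenvalue of $G$ if its eigenspace is not orthogonal to the all-ones vector, i.e. it has an eigenvector whose entries have nonzero sum. The length of a path is its number of edges; a pendant vertex is a vertex of degree $1$. *)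

(* Defs.v *)
From HB Require Import structures.
From mathcomp Require Import all_boot all_order all_algebra.

Set Implicit Arguments.
Unset Strict Implicit.
Unset Printing Implicit Defensive.

Import GRing.Theory Num.Theory.

Record sgraph := SGraph {
  vertex :> finType;
  adj : rel vertex;
  adj_sym : symmetric adj;
  adj_irrefl : irreflexive adj }.

Definition isomorphic (G H : sgraph) : Prop :=
  exists2 f : G -> H, bijective f & forall x y : G, adj (f x) (f y) = adj x y.

Definition connected_graph (G : sgraph) : Prop :=
  forall x y : G, connect (@adj G) x y.

Definition edges (G : sgraph) : {set {set G}} :=
  [set [set x.1; x.2] | x : G * G & adj x.1 x.2].

Definition bicyclic (G : sgraph) : Prop :=
  connected_graph G /\ #|edges G| = #|G| + 1.

Definition deg (G : sgraph) (x : G) : nat := #|[set y : G | adj x y]|.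

(* The default value #|G| is harmless: every degree is smaller than #|G|. *)
Definition min_deg (G : sgraph) : nat := \big[minn/#|G|]_(x : G) deg x.

Section SignlessLaplacian.
Local Open Scope ring_scope.
Variables (R : rcfType) (G : sgraph).

Definition degree_matrix : 'M[R]_#|G| :=
  diag_mx (\row_i (deg (enum_val i : G))%:R).

Definition adjacency_matrix : 'M[R]_#|G| :=
  \matrix_(i, j) (adj (enum_val i : G) (enum_val j : G))%:R.

Definition signless_laplacian : 'M[R]_#|G| :=
  degree_matrix + adjacency_matrix.

(* [eigenspace] is about row vectors; the signless Laplacian is symmetric, so
   left and right eigenvectors agree up to transposition. *)
Definition main_signless_eigenvalue (mu : R) : Prop :=
  eigenvalue signless_laplacian mu /\
  exists2 w : 'rV[R]_#|G|,
    (w <= eigenspace signless_laplacian mu)%MS & \sum_i w ord0 i != 0.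

Definition exactly_two_main_signless_eigenvalues : Prop :=
  exists mu1 mu2 : R, mu1 <> mu2 /\
    forall mu : R, main_signless_eigenvalue mu <-> mu = mu1 \/ mu = mu2.

End SignlessLaplacian.

(* The vertices are:
   - [inl (inl i)] with 0 <= i <= k: the path u = 0, x_1, ..., x_{k-1}, v = k;
   - [inl (inr false)], [inl (inr true)]: the vertices p and q;
   - [inr i] with 0 <= i < k - 1: the pendant vertex y_{i+1}, attached to
     x_{i+1}. *)
Definition theta_vertex (k : nat) : finType := ('I_k.+1 + bool + 'I_k.-1)%type.

Definition theta_arc (k : nat) (a b : theta_vertex k) : bool :=
  match a, b with
  | inl (inl i), inl (inl j) => i.+1 == j :> nat
  | inl (inl i), inl (inr _) => (i == 0 :> nat) || (i == k :> nat)
  | inl (inl i), inr j => i == j.+1 :> nat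
  | _, _ => false
  end.

Definition theta_adj (k : nat) : rel (theta_vertex k) :=
  fun a b => theta_arc a b || theta_arc b a.

Lemma theta_adj_sym (k : nat) : symmetric (@theta_adj k).
Proof. by move=> a b; rewrite /theta_adj orbC. Qed.

Lemma theta_adj_irrefl (k : nat) : irreflexive (@theta_adj k).
Proof.
by rewrite /theta_adj => -[[i|c]|i] //=; rewrite orbb; apply/negbTE; rewrite gtn_eqF.
Qed.

Definition theta_pendant (k : nat) : sgraph :=
  SGraph (@theta_adj_sym k) (@theta_adj_irrefl k).

(* Main.v *)
Require Import Defs.
From mathcomp Require Import all_boot all_order all_algebra.
From mathcomp Require Import complex ring lra zify.

(** The all-ones vector [j] is orthogonal to every eigenvector of a non-main
    eigenvalue, so two main eigenvalues [mu1], [mu2] amount to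
    [(Q - mu1)(Q - mu2) j = 0], i.e. to [d(v)^2 + sum_(u ~ v) d(u) = a d(v) + b]
    for all [v], in a graph which is not regular. Writing [x = d - 1] and [e] for
    the value of [x] at a neighbour of a pendant vertex, this becomes
    [sum_(u ~ v) x(u) + x (x + 1) = c x + e (x + 1)], where [c] is an integer.
    Deleting the pendant vertices leaves a core of minimum degree 2 with either
    two vertices of degree 3 or one of degree 4, and apart from these a core
    vertex has [x = 1] or [x = e]. Comparing the equation at the few kinds of
    core vertices forces [c = e = 2]; then the vertices with [x = 2] form a path
    joining the two branch vertices, and the remaining core vertices are two
    common neighbours of the branch vertices. *)

Set Implicit Arguments.
Unset Strict Implicit.
Unset Printing Implicit Defensive.
Import GRing.Theory Num.Theory.

(** * Main eigenvalues *)

Section MainEigenvalues.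
Local Open Scope ring_scope.
Local Open Scope complex_scope.
Local Open Scope sesquilinear_scope.

Variable R : rcfType.
Local Notation toC := (real_complex R).

Lemma Re_sum_real (I : finType) (z : I -> R[i]) (a : I -> R) :
  complex.Re (\sum_i z i * toC (a i)) = \sum_i complex.Re (z i) * a i.
Proof.
rewrite (big_morph (@complex.Re R) (id1 := 0) (op1 := +%R)) //; last by case=> ? ? [].
by apply: eq_bigr => i _; case: (z i) => x y /=; rewrite mulr0 subr0.
Qed.

Lemma Im_sum_real (I : finType) (z : I -> R[i]) (a : I -> R) :
  complex.Im (\sum_i z i * toC (a i)) = \sum_i complex.Im (z i) * a i.
Proof.
rewrite (big_morph (@complex.Im R) (id1 := 0) (op1 := +%R)) //; last by case=> ? ? [].
by apply: eq_bigr => i _; case: (z i) => x y /=; rewrite mulr0 add0r.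
Qed.

(* The all-ones vector decomposes over an orthonormal eigenbasis, and only the
   components belonging to main eigenvalues are nonzero. *)
Lemma two_main_annihilate n (A : 'M[R]_n) (mu1 mu2 : R) :
    A^T = A ->
    (forall mu (w : 'rV_n), w *m A = mu *: w -> \sum_i w ord0 i != 0 ->
       mu = mu1 \/ mu = mu2) ->
  (const_mx 1 : 'rV_n) *m (A - mu1%:M) *m (A - mu2%:M) = 0.
Proof.
move=> symA main12.
(* The spectral theorem is applied to the hermitian complexification of [A]: the rows of [P] are an
   orthonormal eigenbasis, and [v] holds the coordinates of the all-ones vector in it. *)
pose AC := map_mx toC A.
have symE i j : A i j = A j i by rewrite -[in LHS]symA mxE.
have hermA : AC \is hermsymmx.
  apply/is_hermitianmxP; rewrite expr0 scale1r.
  apply/matrixP => i j; rewrite !mxE symE.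
  by apply/esym/CrealP/complex_realP; exists (A j i).
have /orthomx_spectralP AE := hermitian_normalmx hermA.
have /mxOverP sp_real := hermitian_spectral_diag_real hermA.
have uniP := spectral_unitarymx AC.
have Punit := spectral_unit AC.
set P := spectralmx AC in AE uniP Punit; set sp := spectral_diag AC in AE sp_real.
pose v : 'rV_n := const_mx 1 *m invmx P.
have vE i : v 0 i = (\sum_k P i k)^*.
  rewrite mxE invmx_unitary // rmorph_sum.
  by apply: eq_bigr => k _; rewrite !mxE mul1r.
have eigP i : row i P *m AC = sp 0 i *: row i P.
  by rewrite {1}AE !mulmxA -row_mul mulmxV // -row_mul mul1mx row_diag_mx -scalemxAl -rowE.
have v_sp i : v 0 i != 0 -> sp 0 i = toC mu1 \/ sp 0 i = toC mu2.
  rewrite vE conjC_eq0 => Pi0.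
  have /complex_realP [r rE] := sp_real 0 i.
  have eigR k : \sum_l P i l * toC (A l k) = P i k * toC r.
    have /rowP/(_ k) := eigP i; rewrite !mxE rE mulrC => <-.
    by apply: eq_bigr => l _; rewrite !mxE.
  rewrite rE; suff [->|->] : r = mu1 \/ r = mu2 by [left|right].
  (* As [r] and [A] are real, the real and imaginary parts of the complex eigenvector both satisfy
     the eigenvalue equation, and one of them has nonzero entry sum. *)
  have [Re0|Re1] := eqVneq (\sum_k complex.Re (P i k)) 0.
    apply: (main12 r (\row_k complex.Im (P i k))).
      apply/rowP => k; rewrite !mxE.
      have /(congr1 (@complex.Im R)) := eigR k; rewrite Im_sum_real => E.
      under eq_bigr do rewrite mxE.
      by rewrite E; case: (P i k) => x y /=; rewrite mulr0 add0r mulrC.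
    under eq_bigr do rewrite mxE.
    apply: contraNneq Pi0 => Im0; apply/eqP.
    under eq_bigr do rewrite -[P i _]mulr1.
    have /(_ (fun=> 1)) ReE := @Re_sum_real _ (P i).
    have /(_ (fun=> 1)) ImE := @Im_sum_real _ (P i).
    apply/eqP; rewrite eq_complex ReE ImE /=.
    by under eq_bigr do rewrite mulr1; rewrite Re0 eqxx;
       under eq_bigr do rewrite mulr1; rewrite Im0 eqxx.
  apply: (main12 r (\row_k complex.Re (P i k))); last first.
    by under eq_bigr do rewrite mxE.
  apply/rowP => k; rewrite !mxE.
  have /(congr1 (@complex.Re R)) := eigR k; rewrite Re_sum_real => E.
  under eq_bigr do rewrite mxE.
  by rewrite E; case: (P i k) => x y /=; rewrite mulr0 subr0 mulrC.
have v0 : v *m (diag_mx sp - (toC mu1)%:M) *m (diag_mx sp - (toC mu2)%:M) = 0.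
  have mulE (u : 'rV_n) mu i : (u *m (diag_mx sp - (toC mu)%:M)) 0 i =
      u 0 i * (sp 0 i - toC mu).
    by rewrite -diag_const_mx -linearB /= mul_mx_diag !mxE.
  apply/rowP => i; rewrite !mulE [RHS]mxE.
  have [->|/v_sp [->|->]] := eqVneq (v 0 i) 0; first by rewrite !mul0r.
    by rewrite subrr mulr0 mul0r.
  by rewrite subrr mulr0.
have conjE mu : AC - (toC mu)%:M =
    invmx P *m (diag_mx sp - (toC mu)%:M) *m P.
  by rewrite mulmxBr mulmxBl -AE scalar_mxC -mulmxA mulVmx // mulmx1.
apply: (@map_mx_inj _ _ toC); rewrite map_mx0 !map_mxM !map_mxB.
rewrite !map_scalar_mx /= map_const_mx /= -/AC !conjE.
by rewrite !mulmxA mulmxK // -/v v0 mul0mx.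
Qed.

(** By symmetry of [A], pairing [w] with the annihilated vector gives [(mu - mu1) (mu - mu2)] times
    the entry sum of [w]. *)
Lemma annihilate_mainP n (A : 'M[R]_n) (mu1 mu2 mu : R) (w : 'rV_n) :
    A^T = A ->
    (const_mx 1 : 'rV_n) *m (A - mu1%:M) *m (A - mu2%:M) = 0 ->
    w *m A = mu *: w -> \sum_i w ord0 i != 0 ->
  mu = mu1 \/ mu = mu2.
Proof.
move=> symA ann wA w_neq0.
have wB nu : w *m (A - nu%:M) = (mu - nu) *: w.
  by rewrite mulmxBr wA mul_mx_scalar scalerBl.
have : w *m ((const_mx 1 : 'rV_n) *m (A - mu1%:M) *m (A - mu2%:M))^T = 0.
  by rewrite ann trmx0 mulmx0.
rewrite !trmx_mul !linearB /= symA !tr_scalar_mx !mulmxA wB -scalemxAl wB.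
move/matrixP/(_ 0 0); rewrite -!scalemxAl !mxE.
under eq_bigr do rewrite !mxE mulr1.
move/eqP; rewrite !mulf_eq0 (negPf w_neq0) orbF !subr_eq0.
by case/orP => /eqP ->; [right|left].
Qed.

(** The image of the all-ones vector under [A - mu1] is itself the eigenvector [w]. By symmetry its
    squared norm is [mu2 - mu1] times its entry sum, so a zero sum would force [w = 0]. *)
Lemma annihilate_main n (A : 'M[R]_n) (mu1 mu2 : R) :
    A^T = A -> (const_mx 1 : 'rV_n) *m (A - mu1%:M) *m (A - mu2%:M) = 0 ->
    (const_mx 1 : 'rV_n) *m (A - mu1%:M) != 0 ->
  exists2 w : 'rV_n, w *m A = mu2 *: w & \sum_i w ord0 i != 0.
Proof.
move=> symA ann w_neq0; set w := const_mx 1 *m (A - mu1%:M) in ann w_neq0.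
have wA : w *m A = mu2 *: w.
  by apply/eqP; rewrite -subr_eq0 -mul_mx_scalar -mulmxBr ann.
exists w => //.
have wwE : (w *m w^T) 0 0 = (mu2 - mu1) * \sum_i w ord0 i.
  rewrite {2}/w trmx_mul linearB /= symA tr_scalar_mx mulmxA mulmxBr wA.
  rewrite mul_mx_scalar -scalerBl -scalemxAl mxE trmx_const; congr (_ * _).
  by rewrite mxE; apply: eq_bigr => i _; rewrite [const_mx _ _ _]mxE mulr1.
apply: contraNneq w_neq0 => sw0; move: wwE; rewrite sw0 mulr0 mxE.
move/eqP; rewrite psumr_eq0; last first.
  by move=> i _; rewrite [w^T _ _]mxE -expr2 sqr_ge0.
move/allP => w0; apply/eqP/rowP => i.
have := w0 i (mem_index_enum _).
by rewrite /= [w^T _ _]mxE mulf_eq0 orbb => /eqP ->; rewrite mxE.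
Qed.

(** * The main-eigenvalue condition as an identity between degrees *)

Section Graph.
Variable G : sgraph.
Implicit Types (f : G -> R) (v : G).

Local Notation Q := (signless_laplacian R G).

Definition vertex_row f : 'rV[R]_#|G| := \row_i f (enum_val i).

Lemma signless_laplacian_sym : Q^T = Q.
Proof.
rewrite /signless_laplacian linearD /= /degree_matrix tr_diag_mx; congr (_ + _).
by apply/matrixP => i j; rewrite !mxE adj_sym.
Qed.

Lemma vertex_row_mul f : vertex_row f *m Q =
  vertex_row (fun v => (deg v)%:R * f v + \sum_(u | adj v u) f u).
Proof.
apply/rowP => i; rewrite mulmxDr mul_mx_diag !mxE mulrC; congr (_ + _).
rewrite (reindex_onto enum_rank enum_val) /=; last by move=> k _; rewrite enum_valK.
rewrite [RHS]big_mkcond; apply: eq_big => [u|u _]; first by rewrite enum_rankK eqxx.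
rewrite !mxE enum_rankK adj_sym mulrC.
by case: adj; rewrite ?mul1r ?mul0r.
Qed.

Lemma vertex_row_mulB f (mu : R) : vertex_row f *m (Q - mu%:M) =
  vertex_row (fun v => (deg v)%:R * f v + \sum_(u | adj v u) f u - mu * f v).
Proof.
rewrite mulmxBr vertex_row_mul mul_mx_scalar.
by apply/rowP => i; rewrite !mxE.
Qed.

Lemma vertex_row_eq0 f : vertex_row f = 0 <-> forall v, f v = 0.
Proof.
split=> [/rowP f0 v|f0]; last by apply/rowP => i; rewrite !mxE f0.
by have := f0 (enum_rank v); rewrite !mxE enum_rankK.
Qed.

Lemma sum_adj_const (x : R) v : \sum_(u | adj v u) x = (deg v)%:R * x.
Proof.
by rewrite sumr_const mulr_natl /deg; congr (_ *+ _); apply: eq_card => u; rewrite !inE.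
Qed.

Lemma ones_mul_signless (mu : R) : (const_mx 1 : 'rV_#|G|) *m (Q - mu%:M) =
  vertex_row (fun v => 2%:R * (deg v)%:R - mu).
Proof.
have -> : const_mx 1 = vertex_row (fun=> 1) by apply/rowP => i; rewrite !mxE.
rewrite vertex_row_mulB; apply/rowP => i; rewrite !mxE sum_adj_const.
by rewrite !mulr1 mulr_natl mulr2n.
Qed.

(** [Q] sends the all-ones vector to twice the degree vector, so each entry of the product is twice
    the difference of the two sides; hence the division by 2. *)
Lemma ones_annihilateP (mu1 mu2 : R) :
  (const_mx 1 : 'rV_#|G|) *m (Q - mu1%:M) *m (Q - mu2%:M) = 0 <->
  forall v, (deg v)%:R ^+ 2 + \sum_(u | adj v u) (deg u)%:R =
    (mu1 + mu2) * (deg v)%:R - mu1 * mu2 / 2%:R.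
Proof.
have two0 : 2%:R != 0 :> R by rewrite pnatr_eq0.
rewrite ones_mul_signless vertex_row_mulB vertex_row_eq0.
have E v : (deg v)%:R * (2%:R * (deg v)%:R - mu1) +
    \sum_(u | adj v u) (2%:R * (deg u)%:R - mu1) - mu2 * (2%:R * (deg v)%:R - mu1)
  = 2%:R * ((deg v)%:R ^+ 2 + \sum_(u | adj v u) (deg u)%:R
            - ((mu1 + mu2) * (deg v)%:R - mu1 * mu2 / 2%:R)).
  rewrite sumrB sum_adj_const -mulr_sumr; by field.
split=> H v; last by rewrite E (H v) subrr mulr0.
by have /eqP := H v; rewrite E mulf_eq0 (negPf two0) /= subr_eq0 => /eqP.
Qed.

Lemma main_signless_eigenvalueP (mu : R) : main_signless_eigenvalue G mu <->
  exists2 w : 'rV_#|G|, w *m Q = mu *: w & \sum_i w ord0 i != 0.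
Proof.
split=> [[_ [w /eigenspaceP wQ w0]]|[w wQ w0]]; first by exists w.
split; last by exists w => //; apply/eigenspaceP.
apply/eigenvalueP; exists w => //.
apply: contraNneq w0 => ->.
by rewrite big1 // => i _; rewrite mxE.
Qed.

Lemma two_main_degree_sum : exactly_two_main_signless_eigenvalues R G ->
  exists a b : R, forall v,
    (deg v)%:R ^+ 2 + \sum_(u | adj v u) (deg u)%:R = a * (deg v)%:R + b.
Proof.
case=> mu1 [mu2 [_ main12]]; exists (mu1 + mu2), (- (mu1 * mu2 / 2%:R)).
apply/ones_annihilateP/two_main_annihilate; first exact: signless_laplacian_sym.
by move=> mu w wQ w0; apply/main12/main_signless_eigenvalueP; exists w.
Qed.

(** Two unequal degrees prevent the all-ones vector from being an eigenvector, so neither factor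
    kills it. Taking the two factors in both orders shows that [mu1] and [mu2] are both main. *)
Lemma degree_sum_two_main (mu1 mu2 : R) (x y : G) :
    mu1 != mu2 -> deg x != deg y ->
    (forall v, (deg v)%:R ^+ 2 + \sum_(u | adj v u) (deg u)%:R =
      (mu1 + mu2) * (deg v)%:R - mu1 * mu2 / 2%:R) ->
  exactly_two_main_signless_eigenvalues R G.
Proof.
move=> mu12 degxy degE.
have neq0 mu : (const_mx 1 : 'rV_#|G|) *m (Q - mu%:M) != 0.
  apply/eqP; rewrite ones_mul_signless vertex_row_eq0 => H.
  have : 2%:R * (deg x)%:R - mu = 2%:R * (deg y)%:R - mu by rewrite !H.
  move/addIr/mulfI; rewrite pnatr_eq0 => /(_ isT)/eqP.
  by rewrite eqr_nat (negPf degxy).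
exists mu1, mu2; split; first exact/eqP.
have ann12 := (ones_annihilateP mu1 mu2).2 degE.
have ann21 : (const_mx 1 : 'rV_#|G|) *m (Q - mu2%:M) *m (Q - mu1%:M) = 0.
  by apply/ones_annihilateP => v; rewrite degE [mu2 + _]addrC [mu2 * _]mulrC.
move=> mu; split=> [/main_signless_eigenvalueP [w wQ w0]|].
  exact: annihilate_mainP signless_laplacian_sym ann12 wQ w0.
case=> ->; apply/main_signless_eigenvalueP.
  exact: annihilate_main signless_laplacian_sym ann21 (neq0 _).
exact: annihilate_main signless_laplacian_sym ann12 (neq0 _).
Qed.

(** Comparing coefficients gives [mu1 + mu2 = 6] and [mu1 * mu2 = 4], so the eigenvalues are [3 + s]
    and [3 - s] with [s] the square root of 5. *)
Lemma six_degree_two_main (x y : G) : deg x != deg y ->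
    (forall v, deg v ^ 2 + \sum_(u | adj v u) deg u + 2 = 6 * deg v)%N ->
  exactly_two_main_signless_eigenvalues R G.
Proof.
move=> degxy degE; pose s : R := Num.sqrt 5%:R.
have s2 : s ^+ 2 = 5%:R by rewrite sqr_sqrtr ?ler0n.
have s_gt0 : 0 < s by rewrite sqrtr_gt0 ltr0n.
apply: (@degree_sum_two_main (3%:R + s) (3%:R - s) x y) => // [|v].
  by rewrite -subr_eq0; apply/lt0r_neq0; lra.
have /(congr1 (fun k => k%:R : R)) := degE v.
rewrite natrM !natrD natrX natr_sum => E.
have -> : (3%:R + s) * (3%:R - s) / 2%:R = 2%:R.
  by rewrite mulrC mulrA -[RHS]mulr1; nra.
lra.
Qed.

End Graph.
End MainEigenvalues.

(** * Neighbour sums and the excess equation *)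

Section Neighbours.
Variable G : sgraph.
Implicit Types (u v w : G) (W : {set G}) (f : G -> nat).

Definition nbr_sum f v := \sum_(u | adj v u) f u.

Definition nbr_count W v := nbr_sum (fun u => nat_of_bool (u \in W)) v.

(** The predecessor is exact in a bicyclic graph, where no vertex is isolated. Leaves have excess 0
    and so drop out of neighbour sums of excesses. *)
Definition excess v := (deg v).-1.

Lemma nbr_sum_ge f v u : adj v u -> f u <= nbr_sum f v.
Proof. by move=> vu; rewrite /nbr_sum (bigD1 u) //= leq_addr. Qed.

Lemma nbr_sum_ge2 f v u w : adj v u -> adj v w -> u != w ->
  f u + f w <= nbr_sum f v.
Proof.
move=> vu vw uw; rewrite /nbr_sum (bigD1 u) //= (bigD1 w) /=; last first.
  by rewrite vw eq_sym.
by rewrite addnA leq_addr.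
Qed.

Lemma nbr_sum_ge3 f v u1 u2 u3 : adj v u1 -> adj v u2 -> adj v u3 ->
  u1 != u2 -> u1 != u3 -> u2 != u3 -> f u1 + f u2 + f u3 <= nbr_sum f v.
Proof.
move=> a1 a2 a3 n12 n13 n23; rewrite /nbr_sum (bigD1 u1) //= (bigD1 u2) /=; last first.
  by rewrite a2 eq_sym.
rewrite (bigD1 u3) /=; last by rewrite a3 eq_sym n13 eq_sym n23.
by rewrite !addnA leq_addr.
Qed.

Lemma nbr_sum_eq f g v : (forall u, adj v u -> f u = g u) ->
  nbr_sum f v = nbr_sum g v.
Proof. by move=> fg; apply: eq_bigr. Qed.

Lemma nbr_sum_leq f g v : (forall u, adj v u -> f u <= g u) ->
  nbr_sum f v <= nbr_sum g v.
Proof. by move=> fg; apply: leq_sum. Qed.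

Lemma nbr_sumD f g v : nbr_sum (fun u => f u + g u) v = nbr_sum f v + nbr_sum g v.
Proof. exact: big_split. Qed.

Lemma nbr_sumM k f v : nbr_sum (fun u => k * f u) v = k * nbr_sum f v.
Proof. by rewrite /nbr_sum big_distrr. Qed.

Lemma nbr_sum_eq1 v w : nbr_sum (fun u => nat_of_bool (u == w)) v = adj v w.
Proof.
rewrite /nbr_sum; have [vw|vw] := boolP (adj v w).
  by rewrite (bigD1 w) //= eqxx big1 // => u /andP [_ /negPf ->].
by rewrite big1 // => u vu; case: eqP => // uw; rewrite -uw vu in vw.
Qed.

Lemma degE v : deg v = nbr_sum (fun=> 1) v.
Proof. by rewrite /nbr_sum sum1_card /deg; apply: eq_card => u; rewrite !inE. Qed.

Lemma nbr_countP W v : reflect (exists2 u, u \in W & adj v u) (0 < nbr_count W v).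
Proof.
apply: (iffP idP) => [|[u uW vu]]; last first.
  by apply: leq_trans (nbr_sum_ge _ vu); rewrite uW.
rewrite lt0n sum_nat_eq0 => /forallPn [u].
by rewrite negb_imply eqb0 negbK => /andP [vu uW]; exists u.
Qed.

(** Both sides count the adjacent pairs between [W] and [W']; this double counting later compares
    the sizes of vertex classes. *)
Lemma sum_nbr_count W W' :
  \sum_(v in W) nbr_count W' v = \sum_(v in W') nbr_count W v.
Proof.
have E (V V' : {set G}) : \sum_(v in V) nbr_count V' v =
    \sum_v \sum_u (v \in V) * (u \in V') * adj v u.
  rewrite big_mkcond; apply: eq_bigr => v _; rewrite /nbr_count /nbr_sum.
  case: (v \in V); last by rewrite big1.
  rewrite big_mkcond; apply: eq_bigr => u _.
  by rewrite mul1n; case: adj; rewrite ?muln1 ?muln0.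
rewrite !E exchange_big; apply: eq_bigr => v _; apply: eq_bigr => u _.
by rewrite adj_sym [(u \in W) * _]mulnC.
Qed.

Lemma nbr_count1_uniq W v u w : nbr_count W v <= 1 -> adj v u -> adj v w ->
  u \in W -> w \in W -> u = w.
Proof.
move=> le1 vu vw uW wW; apply/eqP/negPn/negP => uw.
have := nbr_sum_ge2 (fun x => nat_of_bool (x \in W)) vu vw uw.
by rewrite uW wW; move: le1; rewrite /nbr_count; lia.
Qed.

Lemma connected_closed (W : pred G) x : connected_graph G -> W x ->
  (forall u v, W u -> adj u v -> W v) -> forall y, W y.
Proof.
move=> conn Wx closedW y.
have closedW' : closed (@adj G) W.
  move=> u v uv; rewrite !unfold_in; apply/idP/idP => [Wu|Wv]; first exact: closedW uv.
  by apply: closedW Wv _; rewrite adj_sym.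
by have := closed_connect closedW' (conn x y); rewrite !unfold_in Wx => /esym.
Qed.

Lemma handshake : \sum_(v : G) deg v = 2 * #|edges G|.
Proof.
pose D := [set x : G * G | adj x.1 x.2].
have -> : \sum_(v : G) deg v = \sum_(x in D) 1.
  rewrite (eq_bigr (fun v => \sum_(u | adj v u) 1)); last by move=> v _; exact: degE.
  by rewrite pair_big_dep; apply: eq_bigl => x; rewrite inE.
have DE : edges G = [set [set x.1; x.2] | x in D].
  by apply/setP => E; apply/imsetP/imsetP => -[x]; rewrite inE => xD ->;
     exists x; rewrite ?inE.
rewrite DE (partition_big_imset (fun x => [set x.1; x.2])) /=.
rewrite mulnC -sum_nat_const; apply: eq_bigr => E /imsetP [[a b]].
rewrite inE /= => ab ->{E}; rewrite sum1_card.
have anb : a != b by apply: contraTneq ab => ->; rewrite adj_irrefl.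
have <- : #|[set (a, b); (b, a)]| = 2 by rewrite cards2 xpair_eqE negb_and anb.
apply: eq_card => -[u v]; rewrite unfold_in /= !inE !xpair_eqE.
apply/andP/orP => /= [[uv /eqP E]|]; last first.
  case=> /andP [/eqP -> /eqP ->]; first by rewrite ab.
  by rewrite adj_sym ab setUC.
have unv : u != v by apply: contraTneq uv => ->; rewrite adj_irrefl.
have : u \in [set a; b] by rewrite -E !inE eqxx.
have : v \in [set a; b] by rewrite -E !inE eqxx orbT.
rewrite !inE => /orP [] /eqP ? /orP [] /eqP ?; subst; rewrite ?eqxx // ?eqxx in unv *.
  by right.
by left.
Qed.

End Neighbours.

(** * Degrees in a bicyclic graph *)

Section Bicyclic.
Variable G : sgraph.
Hypothesis bicG : bicyclic G.
Implicit Types (u v w : G).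

Let conn := bicG.1.

Lemma bicyclic_sum_deg : \sum_(v : G) deg v = 2 * #|G| + 2.
Proof. by rewrite handshake bicG.2; lia. Qed.

(** An isolated vertex would be the whole connected graph, with degree sum 0. *)
Lemma bicyclic_deg_gt0 v : 0 < deg v.
Proof.
rewrite lt0n; apply/eqP => v0.
have allv : forall y, y == v.
  apply: (@connected_closed _ (pred1 v) v conn) => /= [|u w /eqP -> vw].
    by rewrite /= eqxx.
  by have := nbr_sum_ge (fun=> 1) vw; rewrite -degE v0.
have := bicyclic_sum_deg; rewrite big1 => [|u _]; first by lia.
by rewrite (eqP (allv u)).
Qed.

Lemma deg_excess v : deg v = (excess v).+1.
Proof. by rewrite /excess prednK // bicyclic_deg_gt0. Qed.

Lemma nbr_sum_deg v : nbr_sum (@deg G) v = nbr_sum (@excess G) v + deg v.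
Proof.
rewrite (degE v) -nbr_sumD; apply: nbr_sum_eq => u _.
by rewrite deg_excess addn1.
Qed.

Lemma excess_degE v : excess v = 0 -> deg v = 1.
Proof. by rewrite deg_excess => ->. Qed.

(** Two adjacent leaves would make up the whole connected graph, whose degree sum would then be only
    [#|G|]. *)
Lemma leaf_adj_leaf u v : deg u = 1 -> deg v = 1 -> ~~ adj u v.
Proof.
move=> u1 v1; apply/negP => uv.
have only (x y z : G) : deg x = 1 -> adj x y -> adj x z -> y = z.
  move=> x1 xy xz; apply/eqP/negPn/negP => yz.
  by have := nbr_sum_ge2 (fun=> 1) xy xz yz; rewrite -degE x1.
have all1 : forall y : G, deg y == 1.
  move=> y; suff : (y == u) || (y == v) by case/orP => /eqP ->; apply/eqP.
  apply: (@connected_closed _ (fun y => (y == u) || (y == v)) u conn).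
    by rewrite eqxx.
  move=> x z /orP [] /eqP ->.
    by move=> /(only _ _ _ u1 uv) ->; rewrite eqxx orbT.
  by rewrite adj_sym in uv; move=> /(only _ _ _ v1 uv) ->; rewrite eqxx.
have := bicyclic_sum_deg; rewrite (eq_bigr (fun=> 1)) => [|x _]; last exact/eqP.
have -> : \sum_(x : G) 1 = #|G| by rewrite sum1_card; apply: eq_card.
lia.
Qed.

(* Along a pendant edge the two equations eliminate [a] and [b]; the quotient
   [c] is an integer since the gcd of all excesses divides both sides. *)
Lemma excess_equation (R : rcfType) (a b : R) (l : G) : deg l = 1 ->
    (forall v, (deg v)%:R ^+ 2 + \sum_(u | adj v u) (deg u)%:R =
       a * (deg v)%:R + b)%R ->
  exists c e : nat, 0 < e /\ forall v,
    nbr_sum (@excess G) v + excess v * (excess v).+1 =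
    c * excess v + e * (excess v).+1.
Proof.
move=> l1 degE_R.
have [v0 l_v0] : exists v, adj l v.
  have: 0 < deg l by rewrite l1.
  by rewrite /deg card_gt0 => /set0Pn [v]; rewrite inE; exists v.
pose x v := excess v; pose X v := nbr_sum (@excess G) v.
set e := x v0; set K := X v0.
have Xl : X l = e.
  apply/eqP; rewrite eqn_leq nbr_sum_ge // andbT.
  have := l1; rewrite degE /nbr_sum (bigD1 v0) //= => /eqP.
  rewrite add1n eqSS sum_nat_eq0 => /forallP Hl.
  rewrite /X /nbr_sum (bigD1 v0) //= -[X in _ <= X]addn0 leq_add2l.
  by rewrite leqn0 sum_nat_eq0; apply/forallP => u; apply/implyP => /(implyP (Hl u)).
have e_gt0 : 0 < e.
  rewrite lt0n; apply/eqP => /excess_degE v01.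
  by have := leaf_adj_leaf l1 v01; rewrite l_v0.
have eqR v : (((x v)%:R + 1) ^+ 2 + (X v)%:R + (x v)%:R + 1 =
    a * ((x v)%:R + 1) + b :> R)%R.
  have := degE_R v.
  have -> : (\sum_(u | adj v u) (deg u)%:R = (X v + deg v)%:R :> R)%R.
    by rewrite -nbr_sum_deg natr_sum.
  by rewrite deg_excess natrD -natr1 => <-; rewrite addrA addrA.
(* Subtracting the equation at the leaf [l] removes [b]; multiplying crosswise with the one at its
   neighbour [v0] removes [a]. *)
have eqN v : e * (X v + x v * (x v).+1) = K * x v + e * (e * (x v).+1).
  have xl : x l = 0 by rewrite /x /excess l1.
  have Hl := eqR l; have H0 := eqR v0; have Hv := eqR v.
  rewrite xl Xl -/e -/K in Hl H0.
  apply/eqP; rewrite -(eqr_nat R) !(natrD, natrM) -!natr1.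
  move: (X v)%:R%R (x v)%:R%R e%:R%R K%:R%R Hl H0 Hv => X' x' e' K' Hl H0 Hv.
  have Ev : ((x' + 1) ^+ 2 + X' + x' - 1 - e' = a * x')%R by lra.
  have E0 : ((e' + 1) ^+ 2 + K' - 1 = a * e')%R by lra.
  have E : (e' * ((x' + 1) ^+ 2 + X' + x' - 1 - e')
            = x' * ((e' + 1) ^+ 2 + K' - 1))%R by rewrite Ev E0; ring.
  by apply/eqP; lra.
(* In [eqN] every term but [K * x v] is a multiple of [e * g]. So [e * g] divides each [K * x v],
   hence their gcd [K * g], and [e] divides [K]. *)
pose g := \big[gcdn/0]_v x v.
have g_x v : g %| x v by exact: (biggcdn_inf v).
have g_gt0 : 0 < g by exact: dvdn_gt0 e_gt0 (g_x v0).
have dvK v : e * g %| K * x v.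
  have: e * g %| e * (X v + x v * (x v).+1).
    rewrite dvdn_mul // dvdn_add ?dvdn_mulr ?g_x //.
    by apply: dvdn_sum => u _; exact: g_x.
  by rewrite eqN dvdn_addl // dvdn_mul // dvdn_mulr // g_x.
have /dvdnP [c KE] : e %| K.
  rewrite -(dvdn_pmul2r g_gt0) /g.
  have -> : K * \big[gcdn/0]_v x v = \big[gcdn/0]_v (K * x v).
    by apply: (big_morph (muln K)) => [m n|]; rewrite ?muln_gcdr ?muln0.
  by apply/dvdn_biggcdP => v _; exact: dvK.
exists c, e; split=> // v.
apply/eqP; rewrite -(eqn_pmul2l e_gt0) eqN KE.
by apply/eqP; ring.
Qed.

End Bicyclic.

(** * The core *)

Section Core.
Variable G : sgraph.
Hypothesis bicG : bicyclic G.
Implicit Types (u v w : G) (W : {set G}).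

Definition leaves : {set G} := [set v | deg v == 1].
Definition core : {set G} := ~: leaves.
Definition core_deg v := nbr_count core v.
Definition leaf_bearing : {set G} := [set v in core | 0 < nbr_count leaves v].
(** The index is the excess, so a vertex of [bare i] has [i + 1] neighbours, all in the core. *)
Definition bare i : {set G} :=
  [set v in core | (nbr_count leaves v == 0) && (excess v == i)].

Lemma in_core v : (v \in core) = (deg v != 1).
Proof. by rewrite !inE. Qed.

Lemma leaf_nbr_uniq v u w : v \in leaves -> adj v u -> adj v w -> u = w.
Proof.
rewrite inE => /eqP v1 vu vw; apply/eqP/negPn/negP => uw.
by have := nbr_sum_ge2 (fun=> 1) vu vw uw; rewrite -degE v1.
Qed.

Lemma leaf_nbr_core v u : v \in leaves -> adj v u -> u \in core.
Proof.
rewrite in_core inE => /eqP v1 vu; apply/eqP => u1.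
by have := leaf_adj_leaf bicG v1 u1; rewrite vu.
Qed.

Lemma deg_core_leaves v : deg v = core_deg v + nbr_count leaves v.
Proof.
rewrite degE -nbr_sumD; apply: nbr_sum_eq => u _.
by rewrite [in u \in core]inE; case: (u \in leaves).
Qed.

Lemma leaf_core_deg v : v \in leaves -> nbr_count core v = 1.
Proof.
move=> vl; have := deg_core_leaves v.
have -> : nbr_count leaves v = 0.
  apply/eqP; rewrite -leqn0 leqNgt; apply/negP => /nbr_countP [u ul vu].
  by have := leaf_nbr_core vl vu; rewrite inE ul.
by rewrite addn0 /core_deg => <-; move: vl; rewrite inE => /eqP.
Qed.

(** Each leaf has degree 1 and takes 1 from the degree of its core neighbour, so deleting the leaves
    removes as many edges as vertices and the core keeps one edge more than vertices. *)
Lemma sum_core_deg : \sum_(v in core) core_deg v = 2 * #|core| + 2.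
Proof.
have := bicyclic_sum_deg bicG; rewrite (bigID (mem core)) /=.
rewrite (eq_bigr _ (fun v _ => deg_core_leaves v)) big_split /= (sum_nbr_count core leaves).
rewrite [\sum_(v in leaves) _](eq_bigr (fun=> 1)) => [|v vl]; last exact: leaf_core_deg.
rewrite [X in _ + X = _](eq_bigr (fun=> 1)) => [|v]; last first.
  by rewrite in_core negbK => /eqP.
rewrite [X in _ + X = _](eq_bigl (fun v => v \in leaves)) => [|v]; last first.
  by rewrite in_core negbK inE.
have s1 (W : {set G}) : \sum_(v in W) 1 = #|W| by rewrite sum1_card.
rewrite !s1 -addnA => /(canRL (addnK _)) ->.
by rewrite -(cardsC leaves) -/core; lia.
Qed.

Lemma core_connected W v : v \in core -> v \in W ->
    (forall x y, x \in core -> x \in W -> y \in core -> adj x y -> y \in W) ->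
  forall y, y \in core -> y \in W.
Proof.
move=> vC vW closedW.
(* [V] extends [W] to the leaves through their core neighbours, so that connectedness of the whole
   graph passes to the core. *)
pose V (y : G) := if y \in core then y \in W else nbr_count (core :&: W) y > 0.
suff allV : forall y, V y by move=> y yC; have := allV y; rewrite /V yC.
apply: (@connected_closed _ V v bicG.1); first by rewrite /V vC.
move=> x y; rewrite /V; case: ifPn => xC.
  move=> xW xy; case: ifPn => yC; first exact: closedW xy.
  by apply/nbr_countP; exists x; rewrite 1?inE ?xC // adj_sym.
have xl : x \in leaves by move: xC; rewrite inE negbK.
case/nbr_countP => z; rewrite inE => /andP [zC zW] xz xy.
by rewrite (leaf_nbr_uniq xl xy xz) zC.
Qed.

(** With at most two vertices all core degrees would be at most 1, too small for [sum_core_deg]. The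
    case [v = w] covers a one-vertex core. *)
Lemma core_not_pair v w : ~ (forall u, u \in core -> (u == v) || (u == w)).
Proof.
move=> coreP.
have le1 u : u \in core -> core_deg u <= 1.
  move=> uC; apply: (@leq_trans (adj u v + adj u w)).
    rewrite -!nbr_sum_eq1 -nbr_sumD; apply: nbr_sum_leq => x _.
    by case: (boolP (x \in core)) => // /coreP; do 2 case: eqP.
  by have /orP [/eqP ->|/eqP ->] := coreP u uC; rewrite adj_irrefl; case: adj.
have : \sum_(u in core) core_deg u <= \sum_(u in core) 1 by apply: leq_sum.
by rewrite sum_core_deg sum1_card; lia.
Qed.

(** * The shape of the core under the excess equation *)

Section Equation.
Variables (c e : nat) (l : G).
Hypotheses (l1 : deg l = 1) (e_gt0 : 0 < e).
Hypothesis eqn : forall v,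
  nbr_sum (@excess G) v + excess v * (excess v).+1 =
  c * excess v + e * (excess v).+1.

Let X := nbr_sum (@excess G).

Lemma excess_core v : v \in core -> 0 < excess v.
Proof. by rewrite in_core deg_excess //; lia. Qed.

Lemma excess_leaf v : v \in leaves -> excess v = 0.
Proof. by rewrite inE deg_excess // => /eqP []. Qed.

Lemma leaf_nbr_excess u v : u \in leaves -> adj u v -> excess v = e.
Proof.
move=> ul uv; have := eqn u; rewrite (excess_leaf ul) muln0 mul0n addn0 add0n muln1.
move=> <-; apply/eqP; rewrite eqn_leq nbr_sum_ge //.
rewrite /nbr_sum (bigD1 v) //= big1 ?addn0 // => w /andP [uw].
by rewrite (leaf_nbr_uniq ul uv uw) eqxx.
Qed.

Lemma leaf_bearing_excess v : v \in leaf_bearing -> excess v = e.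
Proof.
rewrite inE => /andP [_ /nbr_countP [u ul vu]].
by apply: leaf_nbr_excess ul _; rewrite adj_sym.
Qed.

Lemma leaf_bearing_nbr_sum v : v \in leaf_bearing -> X v = c * e.
Proof. by move=> /leaf_bearing_excess E; have := eqn v; rewrite -/(X v) E; nia. Qed.

Lemma nbr_sum_core v : core_deg v <= X v.
Proof.
by apply: nbr_sum_leq => u _; case: (boolP (u \in core)) => // /excess_core.
Qed.

(** A core vertex [v] with fewer than two core neighbours bears a leaf. If [w] is its only core
    neighbour, the equations at [v] and [w] leave [w] no core neighbour but [v], so the core would
    be just this pair. *)
Lemma core_deg_ge2 v : v \in core -> 2 <= core_deg v.
Proof.
move=> vC; rewrite leqNgt; apply/negP => dv.
have v_lb : v \in leaf_bearing.
  rewrite inE vC /=; have := deg_core_leaves v.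
  by have := excess_core vC; rewrite deg_excess //; lia.
have xv := leaf_bearing_excess v_lb; have Xv := leaf_bearing_nbr_sum v_lb.
have [dv0|dv1] : core_deg v = 0 \/ core_deg v = 1 by lia.
  apply: (@core_not_pair v v) => u uC; rewrite orbb -in_set1.
  apply: (core_connected vC) uC; first by rewrite inE.
  move=> x y _; rewrite inE => /eqP -> yC vy.
  suff : 0 < core_deg v by rewrite dv0.
  by apply/nbr_countP; exists y.
have [w wC vw] : exists2 w, w \in core & adj v w by apply/nbr_countP; rewrite -/(core_deg v) dv1.
have only_w y : y \in core -> adj v y -> y = w.
  by move=> yC vy; apply: (nbr_count1_uniq (W := core) (v := v)); rewrite -/(core_deg v) ?dv1.
have xw : excess w = c * e.
  rewrite -Xv /X /nbr_sum (bigD1 w) //= big1 ?addn0 // => y /andP [vy yw].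
  apply: excess_leaf; apply: contraNT yw => yl; apply/eqP/only_w => //.
  by rewrite inE.
(* With [excess w = c * e] the equation gives [X w = e - c e (c - 1) (e - 1)], where [c] and [e] are
   positive. *)
have Xw : X w <= e.
  have := eqn w; rewrite -/(X w) xw.
  have := excess_core wC; rewrite xw; case: (c) => [|c']; first by rewrite mul0n.
  by nia.
have wv : adj w v by rewrite adj_sym.
have only_v y : y \in core -> adj w y -> y = v.
  move=> yC wy; apply/eqP/negPn/negP => yv.
  have := nbr_sum_ge2 (@excess G) wy wv yv; rewrite -/(X w) xv.
  by have := excess_core yC; lia.
apply: (@core_not_pair v w) => u uC; rewrite -in_set2.
apply: (core_connected vC) uC; first by rewrite !inE eqxx.
move=> x y _; rewrite !in_set2 => /orP [] /eqP -> yC.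
  by move=> /(only_w _ yC) ->; rewrite eqxx orbT.
by move=> /(only_v _ yC) ->; rewrite eqxx.
Qed.

Lemma bare_excess v : v \in core -> v \notin leaf_bearing ->
  core_deg v = (excess v).+1.
Proof.
move=> vC; rewrite inE vC /= -eqn0Ngt => /eqP l0.
by rewrite -deg_excess // deg_core_leaves l0 addn0.
Qed.

Lemma leaf_bearing_core_deg v : v \in leaf_bearing -> core_deg v <= e.
Proof.
move=> v_lb; have := deg_core_leaves v; rewrite deg_excess //.
rewrite leaf_bearing_excess //; move: v_lb; rewrite inE; lia.
Qed.

Lemma leaf_bearing_ex : exists v, v \in leaf_bearing.
Proof.
have ll : l \in leaves by rewrite inE l1.
have: 0 < nbr_count core l by rewrite leaf_core_deg.
case/nbr_countP => v vC lv; exists v; rewrite inE vC /=.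
by apply/nbr_countP; exists l; rewrite // adj_sym.
Qed.

Lemma sum_core_deg2 : \sum_(v in core) (core_deg v - 2) = 2.
Proof.
have := sum_core_deg.
rewrite (eq_bigr (fun v => (core_deg v - 2) + 2)) => [|v vC]; last first.
  by rewrite subnK // core_deg_ge2.
by rewrite big_split /= sum_nat_const; lia.
Qed.

(* The core is a theta or dumbbell graph (two branch vertices), or two cycles
   sharing one vertex. *)
Lemma core_shape :
  (exists A B, [/\ A \in core, B \in core, A != B, core_deg A = 3 /\ core_deg B = 3 &
     forall v, v \in core -> v != A -> v != B -> core_deg v = 2]) \/
  (exists2 z, z \in core & core_deg z = 4 /\
     forall v, v \in core -> v != z -> core_deg v = 2).
Proof.
have sum2 := sum_core_deg2.
have ge2 v (vC : v \in core) := core_deg_ge2 vC.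
have [A AC dA] : exists2 A, A \in core & 2 < core_deg A.
  apply/exists_inP; rewrite -[X in is_true X]negbK negb_exists_in.
  apply/negP => /forall_inP H; move: sum2; rewrite big1 // => v vC.
  by have := H v vC; lia.
move: sum2; rewrite (bigD1 A) //= => sumA.
have restA v : v \in core -> v != A ->
    core_deg v - 2 <= \sum_(v in core | v != A) (core_deg v - 2).
  by move=> vC vA; rewrite (bigD1 v) ?vC //= leq_addr.
have [dA3|dA4] : core_deg A = 3 \/ core_deg A = 4 by lia.
  left; have [B /andP [BC BA] dB] : exists2 B, (B \in core) && (B != A) & 2 < core_deg B.
    apply/exists_inP; rewrite -[X in is_true X]negbK negb_exists_in.
    apply/negP => /forall_inP H; move: sumA; rewrite big1 => [|v vC]; first by lia.
    by have := H v vC; lia.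
  exists A, B; split=> //; first by rewrite eq_sym.
    by split=> //; have := restA B BC BA; lia.
  move=> v vC vA vB; have := ge2 v vC; move: sumA.
  by rewrite (bigD1 B) ?BC //= (bigD1 v) ?vC ?vA //=; lia.
right; exists A => //; split=> // v vC vA.
by have := ge2 v vC; have := restA v vC vA; lia.
Qed.

(** * Neighbours of a core vertex, counted by class *)

Local Notation p := (nbr_count (bare 1)).
Local Notation a := (nbr_count (bare 2)).
Local Notation b := (nbr_count (bare 3)).
Local Notation m := (nbr_count leaf_bearing).

Lemma core_deg_le4 v : v \in core -> core_deg v <= 4.
Proof.
move=> vC; case: core_shape => [[A [B [AC BC AB [dA dB] H]]]|[z zC [dz H]]].
  have [->|vA] := eqVneq v A; first by rewrite dA.
  by have [->|vB] := eqVneq v B; [rewrite dB|rewrite H].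
by have [->|vz] := eqVneq v z; [rewrite dz|rewrite H].
Qed.

Lemma in_bare i v : (v \in bare i) =
  [&& v \in core, v \notin leaf_bearing & excess v == i].
Proof. by rewrite inE [in _ \in leaf_bearing]inE; case: (v \in core); rewrite //= -eqn0Ngt. Qed.

Variant core_class v : Prop :=
  | CoreBare1 of v \in bare 1 & core_deg v = 2
  | CoreBare2 of v \in bare 2 & core_deg v = 3
  | CoreBare3 of v \in bare 3 & core_deg v = 4
  | CoreLeafBearing of v \in leaf_bearing & 2 <= core_deg v <= e & core_deg v <= 4.

Lemma coreP v : v \in core -> core_class v.
Proof.
move=> vC; have ge2 := core_deg_ge2 vC; have le4 := core_deg_le4 vC.
have [v_lb|v_lb] := boolP (v \in leaf_bearing).
  by apply: CoreLeafBearing => //; rewrite ge2 leaf_bearing_core_deg.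
have dv := bare_excess vC v_lb.
have [E|[E|E]] : excess v = 1 \/ excess v = 2 \/ excess v = 3 by lia.
- by apply: CoreBare1; rewrite ?in_bare ?vC ?v_lb ?E //; lia.
- by apply: CoreBare2; rewrite ?in_bare ?vC ?v_lb ?E //; lia.
- by apply: CoreBare3; rewrite ?in_bare ?vC ?v_lb ?E //; lia.
Qed.

Lemma bareE i v : v \in bare i ->
  [/\ v \in core, v \notin leaf_bearing, excess v = i & core_deg v = i.+1].
Proof.
rewrite in_bare => /and3P [vC v_lb /eqP xv].
by split=> //; rewrite (bare_excess vC v_lb) xv.
Qed.

Lemma bare_neq i j v : i != j -> v \in bare i -> (v \in bare j) = false.
Proof.
move=> ij /bareE [_ _ xv _]; apply/negP => /bareE [_ _ xv' _].
by rewrite -xv -xv' eqxx in ij.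
Qed.

(** Expressing core membership and excess through class indicators lets [core_deg] and [X] be read
    off from the four neighbour counts. *)
Lemma class_counts u : nat_of_bool (u \in core) =
    (u \in bare 1) + (u \in bare 2) + (u \in bare 3) + (u \in leaf_bearing) /\
  excess u = (u \in bare 1) + 2 * (u \in bare 2) + 3 * (u \in bare 3)
             + e * (u \in leaf_bearing).
Proof.
have [uC|uC] := boolP (u \in core); last first.
  have -> : excess u = 0 by apply: excess_leaf; rewrite inE negbK in uC.
  have bF i : (u \in bare i) = false by rewrite in_bare (negPf uC).
  by rewrite !bF inE (negPf uC) /= !muln0.
case: (coreP uC) => ub.
- have [_ /negPf lb xu _] := bareE ub.
  by rewrite ub lb xu (@bare_neq 1 2) // (@bare_neq 1 3) //= !muln0.
- have [_ /negPf lb xu _] := bareE ub.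
  by rewrite ub lb xu (@bare_neq 2 1) // (@bare_neq 2 3) //= !muln0.
- have [_ /negPf lb xu _] := bareE ub.
  by rewrite ub lb xu (@bare_neq 3 1) // (@bare_neq 3 2) //= !muln0.
move=> _ _; have bF i : (u \in bare i) = false by rewrite in_bare ub andbF.
by rewrite !bF ub leaf_bearing_excess //= muln1.
Qed.

Lemma core_deg_profile v : core_deg v = p v + a v + b v + m v.
Proof.
rewrite -!nbr_sumD; apply: nbr_sum_eq => u _.
by have [-> _] := class_counts u.
Qed.

Lemma nbr_sum_profile v : X v = p v + 2 * a v + 3 * b v + e * m v.
Proof.
rewrite -!nbr_sumM -!nbr_sumD; apply: nbr_sum_eq => u _.
by have [_ ->] := class_counts u.
Qed.

(** Core degree and excess equation become two linear conditions on the four counts; this and the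
    next three lemmas reduce the case analysis to integer arithmetic. *)
Lemma bare1_eqn v : v \in bare 1 -> p v + a v + b v + m v = 2 /\
  p v + 2 * a v + 3 * b v + e * m v + 2 = 2 * e + c.
Proof.
move=> vb; have [_ _ xv dv] := bareE vb.
rewrite -core_deg_profile dv -nbr_sum_profile; split=> //.
by have := eqn v; rewrite xv -/(X v); lia.
Qed.

Lemma bare2_eqn v : v \in bare 2 -> p v + a v + b v + m v = 3 /\
  p v + 2 * a v + 3 * b v + e * m v + 6 = 3 * e + 2 * c.
Proof.
move=> vb; have [_ _ xv dv] := bareE vb.
rewrite -core_deg_profile dv -nbr_sum_profile; split=> //.
by have := eqn v; rewrite xv -/(X v); lia.
Qed.

Lemma bare3_eqn v : v \in bare 3 -> p v + a v + b v + m v = 4 /\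
  p v + 2 * a v + 3 * b v + e * m v + 12 = 4 * e + 3 * c.
Proof.
move=> vb; have [_ _ xv dv] := bareE vb.
rewrite -core_deg_profile dv -nbr_sum_profile; split=> //.
by have := eqn v; rewrite xv -/(X v); lia.
Qed.

Lemma leaf_bearing_eqn v : v \in leaf_bearing ->
  p v + a v + b v + m v = core_deg v /\
  p v + 2 * a v + 3 * b v + e * m v = c * e.
Proof.
move=> v_lb; rewrite -core_deg_profile -nbr_sum_profile.
by split=> //; exact: leaf_bearing_nbr_sum.
Qed.

Lemma nbr_count_seq W v (S : seq G) : uniq S ->
    (forall u, u \in W -> u \in S) ->
  nbr_count W v <= \sum_(x <- S) adj v x.
Proof.
move=> uS bS; rewrite /nbr_count.
have -> : \sum_(x <- S) adj v x =
    nbr_sum (fun u => \sum_(x <- S) (u == x)) v.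
  by rewrite /nbr_sum exchange_big; apply: eq_bigr => x _; rewrite -nbr_sum_eq1.
apply: nbr_sum_leq => u _; case: (boolP (u \in W)) => // /bS uS'.
by rewrite (bigD1_seq u) //= eqxx.
Qed.

(** Only the local bounds imposed by two branch vertices of degree 3 are recorded, so a dumbbell
    core satisfies this too. The bound on [a v] holds since [bare 2] lies in [A], [B] and no vertex
    is its own neighbour. *)
Definition theta_core := exists A B, [/\ A \in core, B \in core, A != B,
  core_deg A = 3 /\ core_deg B = 3 &
  forall v, v \in core -> [/\ core_deg v <= 3, b v = 0,
    a v + (core_deg v == 3) <= 2 & core_deg v = 3 -> v = A \/ v = B]].

(** The counterpart for two cycles sharing the vertex [z]. *)
Definition eight_core := exists2 z, z \in core & core_deg z = 4 /\
  forall v, v \in core -> [/\ core_deg v != 3, a v = 0,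
    b v + (core_deg v == 4) <= 1 & core_deg v = 4 -> v = z].

Lemma core_cases : theta_core \/ eight_core.
Proof.
case: core_shape => [[A [B [AC BC AB [dA dB] H]]]|[z zC [dz H]]]; [left|right].
  exists A, B; split=> // v vC.
  have only3 u : u \in core -> core_deg u != 2 -> u \in [:: A; B].
    move=> uC; rewrite !inE; apply: contraNT; rewrite negb_or => /andP [uA uB].
    by rewrite H.
  have le3 u : u \in core -> core_deg u <= 3.
    move=> uC; case: (eqVneq u A) => [->|uA]; first by rewrite dA.
    by case: (eqVneq u B) => [->|uB]; [rewrite dB|rewrite H].
  split; first exact: le3.
  - apply/eqP; rewrite -leqn0 leqNgt; apply/negP => /nbr_countP [u ub _].
    by have [uC _ _ du] := bareE ub; have := le3 u uC; rewrite du.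
  - have uAB : uniq [:: A; B] by rewrite /= inE AB.
    have : a v <= \sum_(x <- [:: A; B]) adj v x.
      apply: nbr_count_seq uAB _ => u ub.
      by have [uC _ _ du] := bareE ub; apply: only3; rewrite ?du.
    rewrite !big_cons big_nil addn0; case: eqP => dv.
      have := only3 v vC; rewrite dv !inE => /(_ isT) /orP [] /eqP ->;
      rewrite adj_irrefl; case: adj => /=; lia.
    by do 2 case: adj => /=; lia.
  by move=> dv; have := only3 v vC; rewrite dv !inE => /(_ isT) /orP [] /eqP; [left|right].
exists z => //; split=> // v vC.
have only4 u : u \in core -> core_deg u != 2 -> u = z.
  by move=> uC; case: (eqVneq u z) => // uz; rewrite H.
split.
- by apply: contraTneq isT => dv; have := only4 v vC; rewrite dv => /(_ isT) vz;
    rewrite vz dz in dv.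
- apply/eqP; rewrite -leqn0 leqNgt; apply/negP => /nbr_countP [u ub _].
  have [uC _ _ du] := bareE ub; have := only4 u uC; rewrite du => /(_ isT) uz.
  by rewrite uz dz in du.
- have : b v <= \sum_(x <- [:: z]) adj v x.
    apply: nbr_count_seq => // u ub; rewrite inE; apply/eqP.
    by have [uC _ _ du] := bareE ub; apply: only4; rewrite ?du.
  rewrite big_cons big_nil addn0; case: eqP => dv.
    by have := only4 v vC; rewrite dv => /(_ isT) ->; rewrite adj_irrefl; lia.
  by case: adj => /=; lia.
- by move=> dv; apply: only4; rewrite ?dv.
Qed.

Lemma leaf_bearing_in_core v : v \in leaf_bearing -> v \in core.
Proof. by rewrite inE => /andP []. Qed.

Lemma leaf_bearing_bounds v : v \in leaf_bearing ->
  [/\ 2 <= core_deg v, core_deg v <= e & core_deg v <= 4].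
Proof.
move=> v_lb; have vC := leaf_bearing_in_core v_lb.
by rewrite core_deg_ge2 // leaf_bearing_core_deg // core_deg_le4.
Qed.

(** * The values of [c] and [e] *)

Lemma e_ge2 : 2 <= e.
Proof.
have [v v_lb] := leaf_bearing_ex.
by have [] := leaf_bearing_bounds v_lb; lia.
Qed.

Lemma c_gt0 : 0 < c.
Proof.
have [v v_lb] := leaf_bearing_ex.
have [v2 _ _] := leaf_bearing_bounds v_lb.
have := nbr_sum_core v; rewrite (leaf_bearing_nbr_sum v_lb).
by case: (c) => //; lia.
Qed.

(** A leaf-bearing vertex has neighbour sum [c * e]. For [c >= 3] only a branch vertex has enough
    core neighbours for this, but then too few of these neighbours bear leaves to reach the sum. *)
Lemma c_le2 : c <= 2.
Proof.
rewrite leqNgt; apply/negP => c3; have e2 := e_ge2.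
have c3e : 3 * e <= c * e by rewrite leq_mul2r c3 orbT.
have [v v_lb] := leaf_bearing_ex.
have [v2 ve v4] := leaf_bearing_bounds v_lb.
have vC := leaf_bearing_in_core v_lb.
case: core_cases => [[A [B [_ _ AB _ H]]]|[z _ [_ H]]].
  have no2 u : u \in leaf_bearing -> core_deg u = 3.
    move=> u_lb; have [u2 _ _] := leaf_bearing_bounds u_lb.
    have [u3 b0 a2 _] := H u (leaf_bearing_in_core u_lb).
    have [E1 E2] := leaf_bearing_eqn u_lb; move: E1 E2 u3 b0 a2.
    by case: (m u) => [|[|[|[|k]]]]; lia.
  have in2 u : u \in leaf_bearing -> u \in [:: A; B].
    move=> u_lb; have [_ _ _ /(_ (no2 u u_lb))] := H u (leaf_bearing_in_core u_lb).
    by rewrite !inE; case=> ->; rewrite eqxx ?orbT.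
  have m1 : m v <= 1.
    apply: leq_trans (nbr_count_seq v _ in2) _; first by rewrite /= inE AB.
    have := in2 v v_lb; rewrite !big_cons big_nil addn0 !inE.
    by case/orP => /eqP ->; rewrite adj_irrefl; case: adj.
  have [v3 b0 a2 _] := H v vC.
  have [E1 E2] := leaf_bearing_eqn v_lb; move: E1 E2 m1.
  by case: (m v) => [|[|k]]; lia.
have no2 u : u \in leaf_bearing -> core_deg u = 4.
  move=> u_lb; have [u2 _ u4] := leaf_bearing_bounds u_lb.
  have [u3 a0 b1 _] := H u (leaf_bearing_in_core u_lb).
  have [E1 E2] := leaf_bearing_eqn u_lb; move: E1 E2 u3 a0 b1.
  by case: (m u) => [|[|[|k]]]; lia.
have in1 u : u \in leaf_bearing -> u \in [:: z].
  move=> u_lb; have [_ _ _ /(_ (no2 u u_lb))] := H u (leaf_bearing_in_core u_lb).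
  by rewrite inE => ->.
have m0 : m v <= 0.
  apply: leq_trans (nbr_count_seq v _ in1) _ => //.
  have := in1 v v_lb; rewrite big_cons big_nil addn0 inE => /eqP ->.
  by rewrite adj_irrefl.
have [_ a0 b1 _] := H v vC.
have [E1 E2] := leaf_bearing_eqn v_lb; move: E1 E2 m0.
by case: (m v) => [|k]; lia.
Qed.

(** With [c = 1], a leaf-bearing vertex has neighbour sum [e] spread over at least two core
    neighbours, so none of them has excess [e], and the branch bounds cap the sum at 4. For [e = 2]
    a branch vertex bears no leaf, and its equation demands a neighbour sum below its core
    degree. *)
Lemma c1_e_le4 : c = 1 -> 3 <= e <= 4 /\ (forall v, v \in leaf_bearing -> m v = 0).
Proof.
move=> c1; have e2 := e_ge2.
have mle v : v \in leaf_bearing -> m v = 0 /\ e <= 4.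
  move=> v_lb; have [v2 ve v4] := leaf_bearing_bounds v_lb.
  have vC := leaf_bearing_in_core v_lb.
  have [E1 E2] := leaf_bearing_eqn v_lb; rewrite c1 mul1n in E2.
  case: core_cases => [[A [B [_ _ _ _ /(_ v vC) []]]]|[z _ [_ /(_ v vC) []]]];
    move=> H1 H2 H3 _; move: E1 E2 H1 H2 H3;
    by case: (m v) => [|[|k]]; lia.
have e4 : e <= 4 by have [v /mle []] := leaf_bearing_ex.
split; last by move=> v /mle [].
rewrite e4 andbT ltn_neqAle e2 andbT; apply/eqP => e2'.
case: core_cases => [[A [B [AC _ _ [dA _] H]]]|[z zC [dz H]]].
  case: (coreP AC); rewrite dA -?e2' ?c1 => // Ab _.
  by have := bare2_eqn Ab; rewrite -e2' c1; lia.
case: (coreP zC); rewrite dz -?e2' ?c1 => // zb _.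
by have := bare3_eqn zb; rewrite -e2' c1; lia.
Qed.

Lemma theta_bare3 : theta_core -> bare 3 = set0.
Proof.
move=> [A [B [_ _ _ _ H]]]; apply/setP => v; rewrite in_set0; apply/negP => vb.
by have [vC _ _ dv] := bareE vb; have [] := H v vC; rewrite dv.
Qed.

Lemma core_sum_split f : \sum_(v in core) f v =
  \sum_(v in bare 1) f v + \sum_(v in bare 2) f v + \sum_(v in bare 3) f v
  + \sum_(v in leaf_bearing) f v.
Proof.
rewrite ![\sum_(v in _) _]big_mkcond -!big_split /=.
apply: eq_bigr => v _; have [+ _] := class_counts v.
by do 5 case: (_ \in _) => //=; rewrite ?addn0 ?add0n.
Qed.

Lemma eq_sum_const (W : {set G}) (f : G -> nat) k :
  (forall v, v \in W -> f v = k) -> \sum_(v in W) f v = k * #|W|.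
Proof. by move=> fk; rewrite (eq_bigr _ fk) sum_nat_const mulnC. Qed.

Lemma c1_e3 : c = 1 -> e = 3 -> False.
Proof.
move=> c1 e3; have [_ m0] := c1_e_le4 c1.
case: core_cases => [[A [B [_ _ _ _ H]]]|[z zC [dz H]]]; last first.
  case: (coreP zC); rewrite dz ?e3 => // zb _.
  by have := bare3_eqn zb; rewrite e3 c1; lia.
have P v : v \in bare 1 -> a v = 1 /\ m v = 1.
  move=> vb; have [vC _ _ _] := bareE vb; have [_ b0 a2 _] := H v vC.
  by have := bare1_eqn vb; rewrite e3 c1; lia.
have Q v : v \in bare 2 -> p v = 2 /\ m v = 1.
  move=> vb; have [vC _ _ dv] := bareE vb; have [_ b0 a2 _] := H v vC.
  by have := bare2_eqn vb; rewrite e3 c1 dv in a2 *; lia.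
have L v : v \in leaf_bearing ->
    p v = 1 + 2 * (core_deg v - 2) /\ a v + (core_deg v - 2) = 1.
  move=> v_lb; have [d3 b0 a2 _] := H v (leaf_bearing_in_core v_lb).
  have [v2 _ _] := leaf_bearing_bounds v_lb; have mv := m0 v v_lb.
  have := leaf_bearing_eqn v_lb; rewrite e3 c1; lia.
(* Let [n1], [n2], [n] be the sizes of [bare 1], [bare 2], [leaf_bearing], and [s2] the sum of
   [core_deg v - 2] over the last. Double counting gives [n1 = 2 n2], [n1 = n + 2 s2] and
   [n = n2 + s2], hence [n2 = 3 s2]; but [n2 + s2 = 2], so [4 s2 = 2]. *)
have := sum_core_deg2; rewrite core_sum_split.
rewrite (@eq_sum_const (bare 1) _ 0); last by move=> v /bareE [_ _ _ ->].
rewrite (@eq_sum_const (bare 2) _ 1); last by move=> v /bareE [_ _ _ ->].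
rewrite theta_bare3 ?big_set0; last by case: core_cases => // -[z zC [dz _]];
  have [] := H z zC; rewrite dz.
have := sum_nbr_count (bare 1) (bare 2).
rewrite (@eq_sum_const (bare 1) _ 1); last by move=> v /P [].
rewrite (@eq_sum_const (bare 2) _ 2); last by move=> v /Q [].
have := sum_nbr_count (bare 1) leaf_bearing.
rewrite (@eq_sum_const (bare 1) _ 1); last by move=> v /P [].
rewrite [\sum_(v in leaf_bearing) _](eq_bigr _ (fun v Hv => (L v Hv).1)).
rewrite big_split /= -big_distrr /= sum_nat_const.
have := sum_nbr_count (bare 2) leaf_bearing.
rewrite (@eq_sum_const (bare 2) _ 1); last by move=> v /Q [].
have : \sum_(v in leaf_bearing) (a v + (core_deg v - 2)) = 1 * #|leaf_bearing|.
  by apply: eq_sum_const => v /L [].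
rewrite big_split /=.
set s1 := \sum_(v in _) a v; set s2 := \sum_(v in _) (core_deg v - 2).
by lia.
Qed.

(** With two branch vertices, [bare 1] and then [bare 2] are empty, and a leaf-bearing vertex has no
    admissible neighbour. With one, double counting makes [bare 1] three times as large as [bare 3]
    and both as large as [leaf_bearing], which would be empty. *)
Lemma c1_e4 : c = 1 -> e = 4 -> False.
Proof.
move=> c1 e4; have [_ m0] := c1_e_le4 c1.
have [v0 v0_lb] := leaf_bearing_ex.
case: core_cases => [[A [B [_ _ _ _ H]]]|[z zC [dz H]]].
  have P v : v \in bare 1 -> False.
    move=> vb; have [vC _ _ _] := bareE vb; have [_ b0 a2 _] := H v vC.
    by have := bare1_eqn vb; rewrite e4 c1; lia.
  have p0 v : p v = 0.
    by apply/eqP; rewrite -leqn0 leqNgt; apply/negP => /nbr_countP [u /P].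
  have Q v : v \in bare 2 -> False.
    move=> vb; have [vC _ _ dv] := bareE vb; have [_ b0 a2 _] := H v vC.
    by have := bare2_eqn vb; rewrite p0 e4 c1 dv in a2 *; lia.
  have a0 v : a v = 0.
    by apply/eqP; rewrite -leqn0 leqNgt; apply/negP => /nbr_countP [u /Q].
  have [_ b0 _ _] := H v0 (leaf_bearing_in_core v0_lb).
  by have := leaf_bearing_eqn v0_lb; rewrite p0 a0 b0 m0 // e4 c1; lia.
have P v : v \in bare 1 -> b v = 1 /\ m v = 1.
  move=> vb; have [vC _ _ _] := bareE vb; have [_ a0 b1 _] := H v vC.
  by have := bare1_eqn vb; rewrite e4 c1; lia.
have Q v : v \in bare 3 -> p v = 3 /\ m v = 1.
  move=> vb; have [vC _ _ dv] := bareE vb; have [_ a0 b1 _] := H v vC.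
  by have := bare3_eqn vb; rewrite e4 c1 dv in b1 *; lia.
have L v : v \in leaf_bearing -> p v = 1 /\ b v = 1.
  move=> v_lb; have vC := leaf_bearing_in_core v_lb.
  have [d3 a0 b1 dz'] := H v vC.
  have [v2 _ v4] := leaf_bearing_bounds v_lb; have mv := m0 v v_lb.
  have [E1 E2] := leaf_bearing_eqn v_lb; rewrite mv e4 c1 a0 in E1 E2.
  have [d2|d4] : core_deg v = 2 \/ core_deg v = 4 by lia.
    by lia.
  (* Here [v] is [z], but a neighbour of [v] in [bare 1] is adjacent to a vertex of [bare 3], which
     is [z] as well and bears no leaf. *)
  have /nbr_countP [u /P [bu _] _] : 0 < p v by lia.
  have /nbr_countP [w wb _] : 0 < b u by rewrite bu.
  have [wC w_lb _ dw] := bareE wb.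
  have [_ _ _ wz] := H w wC.
  by rewrite (wz dw) -(dz' d4) v_lb in w_lb.
have E1 := sum_nbr_count (bare 1) (bare 3).
rewrite (@eq_sum_const (bare 1) _ 1) in E1; last by move=> v /P [].
rewrite (@eq_sum_const (bare 3) _ 3) in E1; last by move=> v /Q [].
have E2 := sum_nbr_count (bare 1) leaf_bearing.
rewrite (@eq_sum_const (bare 1) _ 1) in E2; last by move=> v /P [].
rewrite (@eq_sum_const leaf_bearing _ 1) in E2; last by move=> v /L [].
have E3 := sum_nbr_count (bare 3) leaf_bearing.
rewrite (@eq_sum_const (bare 3) _ 1) in E3; last by move=> v /Q [].
rewrite (@eq_sum_const leaf_bearing _ 1) in E3; last by move=> v /L [].
have : 0 < #|leaf_bearing| by apply/card_gt0P; exists v0.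
by lia.
Qed.

Lemma c_eq2 : c = 2.
Proof.
have := c_gt0; have := c_le2; case: (eqVneq c 1) => [c1 _ _|]; last by lia.
have [e34 _] := c1_e_le4 c1.
by have [/(c1_e3 c1)|/(c1_e4 c1)] : e = 3 \/ e = 4 by lia.
Qed.

(** All neighbours of a vertex in [bare 1] have excess 3. With two branch vertices this empties
    [bare 2], and a leaf-bearing branch vertex fails by parity. With one, [z] has a neighbour in
    [bare 1], which needs a leaf-bearing neighbour whose own equation excludes it. *)
Lemma c2_e3 : e = 3 -> False.
Proof.
move=> e3; have c2 := c_eq2.
have P v : v \in bare 1 -> p v = 0 /\ a v = 0.
  by move=> vb; have := bare1_eqn vb; rewrite e3 c2; lia.
have Padj v u : v \in bare 1 -> u \in bare 2 -> adj v u -> False.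
  move=> vb ub vu; have : 0 < a v by apply/nbr_countP; exists u.
  by have [_ ->] := P v vb.
case: core_cases => [[A [B [AC _ _ [dA _] H]]]|[z zC [dz H]]].
  have Q v : v \in bare 2 -> False.
    move=> vb; have [vC _ _ dv] := bareE vb; have [_ b0 a2 _] := H v vC.
    have /nbr_countP [u ub vu] : 0 < p v.
      by have := bare2_eqn vb; rewrite e3 c2 dv in a2 *; lia.
    by apply: (Padj u v ub vb); rewrite adj_sym.
  have a0 v : a v = 0.
    by apply/eqP; rewrite -leqn0 leqNgt; apply/negP => /nbr_countP [u /Q].
  case: (coreP AC); rewrite dA => //; [by move=> /Q|move=> A_lb _ _].
  have [_ b0 _ _] := H A AC.
  by have := leaf_bearing_eqn A_lb; rewrite dA a0 b0 e3 c2; lia.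
case: (coreP zC); rewrite dz ?e3 => // zb _.
have [_ az bz _] := H z zC; rewrite dz in bz.
have /nbr_countP [u ub zu] : 0 < p z.
  by have := bare3_eqn zb; rewrite e3 c2; lia.
have [uC _ _ _] := bareE ub; have [_ _ bu _] := H u uC.
have /nbr_countP [w w_lb uw] : 0 < m u.
  by have := bare1_eqn ub; have := P u ub; rewrite e3 c2; lia.
have : 0 < p w by apply/nbr_countP; exists u; rewrite // adj_sym.
have wC := leaf_bearing_in_core w_lb; have [d3 aw bw _] := H w wC.
have [w2 we w4] := leaf_bearing_bounds w_lb.
by have := leaf_bearing_eqn w_lb; rewrite e3 c2 in we *; lia.
Qed.

(** A neighbour sum [2 * e] with [e >= 4] is reached only with core degree 2 and two leaf-bearing
    neighbours. The leaf-bearing vertices then fill the core and leave no branch vertex. *)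
Lemma c2_e_ge4 : 4 <= e -> False.
Proof.
move=> e4; have c2 := c_eq2.
have closed v : v \in leaf_bearing -> core_deg v = 2 /\ m v = 2.
  move=> v_lb; have vC := leaf_bearing_in_core v_lb.
  have [v2 ve v4] := leaf_bearing_bounds v_lb.
  have [E1 E2] := leaf_bearing_eqn v_lb; rewrite c2 in E2.
  case: core_cases => [[A [B [_ _ _ _ /(_ v vC) []]]]|[z _ [_ /(_ v vC) []]]];
    move=> H1 H2 H3 _; move: E1 E2 H1 H2 H3;
    by case: (m v) => [|[|[|[|[|k]]]]]; lia.
have [v0 v0_lb] := leaf_bearing_ex.
have all_lb u : u \in core -> u \in leaf_bearing.
  apply: (core_connected (leaf_bearing_in_core v0_lb)) => // x y _ x_lb yC xy.
  case: (boolP (y \in leaf_bearing)) => // y_lb.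
  have [dx mx] := closed x x_lb.
  have : nbr_sum (fun w => (w \in leaf_bearing) + (w == y)) x <= core_deg x.
    apply: nbr_sum_leq => w _; case: eqP => [->|_]; first by rewrite yC (negPf y_lb).
    rewrite addn0; case: (boolP (w \in leaf_bearing)) => // /leaf_bearing_in_core.
    by move=> ->.
  by rewrite nbr_sumD nbr_sum_eq1 xy -/(nbr_count _ _) mx dx.
case: core_cases => [[A [B [AC _ _ [dA _] H]]]|[z zC [dz H]]].
  by have [] := closed A (all_lb A AC); rewrite dA.
by have [] := closed z (all_lb z zC); rewrite dz.
Qed.

Lemma e_eq2 : e = 2.
Proof.
have := e_ge2; have [/c2_e_ge4|] := leqP 4 e; first by [].
by case: (eqVneq e 3) => [/c2_e3|]; lia.
Qed.

(** Leaf-bearing vertices now have core degree 2, so the branch vertices are bare. In the target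
    graph [A], [B] become the ends of the long path, [bare 1] the middles of the two short paths,
    and [leaf_bearing] the inner vertices of the long one. *)
Lemma extremal_structure : exists A B, [/\ A != B,
  bare 2 = [set A; B],
  forall v, [|| v \in leaves, v \in bare 1, v \in bare 2 | v \in leaf_bearing],
  forall v, v \in bare 1 -> a v = 2 /\ p v = 0 &
  (forall v, v \in bare 2 -> p v = 2 /\ a v + m v = 1) /\
  (forall v, v \in leaf_bearing -> deg v = 3 /\ a v + m v = 2)].
Proof.
have c2 := c_eq2; have e2 := e_eq2.
case: core_cases => [[A [B [AC BC AB [dA dB] H]]]|[z zC [dz H]]]; last first.
  case: (coreP zC); rewrite dz ?e2 => // zb _.
  by have := bare3_eqn zb; rewrite e2 c2; lia.
have L v : v \in leaf_bearing -> p v = 0 /\ a v + m v = 2.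
  move=> v_lb; have [_ b0 _ _] := H v (leaf_bearing_in_core v_lb).
  have [v2 ve _] := leaf_bearing_bounds v_lb.
  by have := leaf_bearing_eqn v_lb; rewrite e2 c2 in ve *; lia.
have Q v : v \in bare 2 -> p v = 2 /\ a v + m v = 1.
  move=> vb; have [vC _ _ dv] := bareE vb; have [_ b0 _ _] := H v vC.
  by have := bare2_eqn vb; rewrite e2 c2; lia.
have in2 v : v \in core -> core_deg v = 3 -> v \in bare 2.
  by move=> vC dv; case: (coreP vC); rewrite dv // e2.
have LD v : v \in leaf_bearing -> deg v = 3 /\ a v + m v = 2.
  by move=> v_lb; have [] := L v v_lb; rewrite deg_excess // leaf_bearing_excess // e2.
exists A, B; split=> //.
- apply/setP => v; rewrite in_set2; apply/idP/orP => [vb|].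
    by have [vC _ _ dv] := bareE vb; have [_ _ _ /(_ dv)] := H v vC;
       case=> ->; [left|right].
  by case=> /eqP ->; apply: in2.
- move=> v; case: (boolP (v \in leaves)) => //= vl.
  have vC : v \in core by rewrite inE.
  case: (coreP vC) => [->|->|vb|->] //; rewrite ?orbT //.
  by have [_ _ _ dv] := bareE vb; have [] := H v vC; rewrite dv.
- move=> v vb; have [vC _ _ _] := bareE vb; have [_ b0 _ _] := H v vC.
  have m0 : m v = 0.
    apply/eqP; rewrite -leqn0 leqNgt; apply/negP => /nbr_countP [u u_lb vu].
    have : 0 < p u by apply/nbr_countP; exists v; rewrite // adj_sym.
    by have [-> _] := L u u_lb.
  by have := bare1_eqn vb; rewrite e2 c2; lia.
Qed.

End Equation.
End Core.

(** * The extremal graphs *)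

Section ThetaDegrees.
Variable n : nat.
Local Notation H := (theta_pendant n.+2).

(** Natural-number indices ease the arithmetic; [inord] is faithful for [i < n.+3], and the indices
    in [theta_nbrs] stay in that range. *)
Definition theta_path (i : nat) : H := inl (inl (inord i)).
Definition theta_leaf (i : nat) : H := inr (inord i).
Definition theta_mid (c : bool) : H := inl (inr c).

Definition theta_nbrs (x : H) : seq H :=
  match x with
  | inl (inl i) =>
      if i == 0 :> nat then [:: theta_path 1; theta_mid false; theta_mid true]
      else if i == n.+2 :> nat then
        [:: theta_path n.+1; theta_mid false; theta_mid true]
      else [:: theta_path i.-1; theta_path i.+1; theta_leaf i.-1]
  | inl (inr _) => [:: theta_path 0; theta_path n.+2]
  | inr j => [:: theta_path j.+1]
  end.

Lemma eq_theta_path (i : 'I_n.+3) j : j < n.+3 ->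
  (inl (inl i) == theta_path j :> H) = (i == j :> nat).
Proof.
move=> lt_j; rewrite /theta_path; apply/eqP/eqP => [[->]|ij].
  by rewrite inordK.
by congr (inl (inl _)); apply: val_inj; rewrite /= inordK.
Qed.

Lemma eq_theta_leaf (i : 'I_n.+1) j : j < n.+1 ->
  (inr i == theta_leaf j :> H) = (i == j :> nat).
Proof.
move=> lt_j; rewrite /theta_leaf; apply/eqP/eqP => [[->]|ij].
  by rewrite inordK.
by congr inr; apply: val_inj; rewrite /= inordK.
Qed.

Lemma mem_theta_nbrs (x y : H) : (y \in theta_nbrs x) = adj x y.
Proof.
have midE (c c' : bool) : (inl (inr c) == theta_mid c') = (c == c') by [].
have pmidE (i : 'I_n.+3) c' : (inl (inl i) == theta_mid c') = false by [].
have lmidE (j : 'I_n.+1) c' : (inr j == theta_mid c') = false by [].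
have pleafE x' j : (inl x' == theta_leaf j :> H) = false by [].
rewrite /= /theta_adj.
case: x => [[i|c]|j]; rewrite /theta_nbrs; last first.
- have := ltn_ord j => /= lj.
  case: y => [[i|c]|j'] //=; rewrite !inE ?eq_theta_path //; lia.
- case: y => [[i|c']|j'] //=; rewrite !inE ?eq_theta_path //; lia.
have := ltn_ord i => li.
case: eqP => i0; [|case: eqP => ik];
  case: y => [[i'|c]|j'] /=; rewrite !inE ?eq_theta_path ?eq_theta_leaf //=;
  rewrite ?midE ?pmidE ?lmidE ?pleafE;
  by [have := ltn_ord i'; lia|case: c; lia|have /= := ltn_ord j'; lia].
Qed.

Lemma uniq_theta_nbrs (x : H) : uniq (theta_nbrs x).
Proof.
case: x => [[i|c]|j] //; rewrite /theta_nbrs.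
  have := ltn_ord i => li.
  case: eqP => // i0; case: eqP => //= ik.
  rewrite !inE !eq_theta_path ?inordK //; try lia.
  by rewrite orbF andbT; lia.
by rewrite /= !inE eq_theta_path // inordK.
Qed.

Lemma nbr_sum_theta (f : H -> nat) (x : H) :
  nbr_sum f x = \sum_(y <- theta_nbrs x) f y.
Proof.
rewrite [RHS]big_uniq ?uniq_theta_nbrs //.
by apply: eq_bigl => y; rewrite mem_theta_nbrs.
Qed.

Definition theta_degree (x : H) : nat :=
  match x with inl (inl _) => 3 | inl (inr _) => 2 | inr _ => 1 end.

Lemma theta_deg (x : H) : deg x = theta_degree x.
Proof.
rewrite degE nbr_sum_theta sum1_size.
by case: x => [[i|c]|j] //=; case: eqP => // _; case: eqP.
Qed.

Lemma theta_six_degree (x : H) : deg x ^ 2 + nbr_sum (@deg H) x + 2 = 6 * deg x.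
Proof.
rewrite (nbr_sum_eq (fun y _ => theta_deg y)) theta_deg nbr_sum_theta.
by case: x => [[i|c]|j] /=; do ?case: eqP => _; rewrite !big_cons big_nil.
Qed.

End ThetaDegrees.

Lemma isomorphic_nbr_sum (G H : sgraph) (f : G -> H) (g : H -> nat) :
    bijective f -> (forall x y, adj (f x) (f y) = adj x y) ->
  forall v, nbr_sum g (f v) = nbr_sum (g \o f) v.
Proof.
move=> bij_f adjf v; rewrite /nbr_sum (reindex f) /=; last exact: onW_bij.
by apply: eq_bigl => u; rewrite adjf.
Qed.

(* Injectivity and equal degrees make [h] a local isomorphism, so its image is
   closed under adjacency and connectedness gives surjectivity. *)
Lemma hom_deg_isomorphic (G H : sgraph) (h : H -> G) (a0 : H) :
    connected_graph G -> injective h ->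
    (forall a b, adj a b -> adj (h a) (h b)) ->
    (forall a, deg (h a) = deg a) ->
  isomorphic G H.
Proof.
move=> conn inj_h homh degh.
have nbrh a : [set y | adj (h a) y] = h @: [set b | adj a b].
  apply/esym/eqP; rewrite eqEcard card_imset // -/(deg a) -/(deg (h a)) degh leqnn.
  rewrite andbT; apply/subsetP => _ /imsetP [b + ->]; rewrite !inE; exact: homh.
have adjh a b : adj (h a) (h b) = adj a b.
  apply/idP/idP => [hab|]; last exact: homh.
  have : h b \in [set y | adj (h a) y] by rewrite inE.
  by rewrite nbrh => /imsetP [b']; rewrite inE => ab' /inj_h ->.
have surj : forall y, y \in codom h.
  apply: (@connected_closed _ (mem (codom h)) (h a0) conn) => [|u v].
    exact: codom_f.
  case/codomP => a -> av; have : v \in [set y | adj (h a) y] by rewrite inE.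
  by rewrite nbrh => /imsetP [b _ ->]; exact: codom_f.
pose f y := iinv (surj y).
have hf y : h (f y) = y by exact: f_iinv.
have fh a : f (h a) = a by apply: inj_h; rewrite hf.
exists f => [|x y]; first by exists h.
by rewrite -adjh !hf.
Qed.

(** * Following vertices of induced degree 2 from one end to the other *)

Section PathBetween.
Variables (G : sgraph) (T : {set G}) (A B : G).
Hypotheses (AT : A \in T) (A_neq_B : A != B).
Hypotheses (degA : nbr_count T A = 1) (degB : nbr_count T B = 1).
Hypothesis degT : forall v, v \in T -> v != A -> v != B -> nbr_count T v = 2.

Definition path_from (n : nat) (g : nat -> G) :=
  [/\ g 0 = A, forall i, i <= n -> g i \in T,
      forall i, i < n -> adj (g i) (g i.+1) &
      forall i j, i <= n -> j <= n -> g i = g j -> i = j].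

Lemma degT_le2 v : v \in T -> nbr_count T v <= 2.
Proof.
move=> vT; have [->|vA] := eqVneq v A; first by rewrite degA.
by have [->|vB] := eqVneq v B; [rewrite degB|rewrite degT].
Qed.

Lemma nbr_count_ge2 v u w : adj v u -> adj v w -> u != w ->
  u \in T -> w \in T -> 2 <= nbr_count T v.
Proof.
move=> vu vw uw uT wT.
by have := nbr_sum_ge2 (fun x => nat_of_bool (x \in T)) vu vw uw; rewrite uT wT.
Qed.

Lemma path_extend n g : path_from n g -> g n != B ->
  exists g', path_from n.+1 g'.
Proof.
case=> g0 gT gadj ginj gB.
suff [w [wT zw wg]] : exists w, [/\ w \in T, adj (g n) w &
    forall i, i <= n -> w != g i].
  exists (fun i => if i <= n then g i else w); split.
  - by rewrite leq0n.
  - by move=> i _; case: ifP => // /gT.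
  - move=> i lt_i; rewrite -ltnS lt_i; case: ifP => lt_i'; first exact: gadj.
    by have -> : i = n by lia.
  - move=> i j le_i le_j; case: ifPn => hi; case: ifPn => hj; try by lia.
    + exact: ginj.
    + by move=> E; have := wg i hi; rewrite E eqxx.
    + by move=> E; have := wg j hj; rewrite E eqxx.
case: n => [|n] in gT gadj ginj gB *.
  have /nbr_countP [w wT Aw] : 0 < nbr_count T A by rewrite degA.
  exists w; rewrite g0; split=> // i; rewrite leqn0 => /eqP ->; rewrite g0.
  by apply: contraTneq Aw => ->; rewrite adj_irrefl.
have zA : g n.+1 != A.
  by apply/eqP; rewrite -g0 => /ginj; rewrite leqnn leq0n => /(_ isT isT).
have zT : g n.+1 \in T by exact: gT.
have zy : adj (g n.+1) (g n) by rewrite adj_sym gadj.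
have [w /andP [zw wy] wT] : exists2 w, adj (g n.+1) w && (w != g n) & w \in T.
  apply/exists_inP; rewrite -[X in is_true X]negbK negb_exists_in.
  apply/negP => /forall_inP none.
  have : nbr_count T (g n.+1) <= adj (g n.+1) (g n).
    rewrite -nbr_sum_eq1; apply: nbr_sum_leq => u zu.
    case: eqP => [_|/eqP uy]; first by case: (_ \in _).
    by have := none u; rewrite zu uy => /(_ isT) /negPf ->.
  by rewrite degT // zy.
exists w; split=> // i le_i; have [->|lt_i] := eqVneq i n.+1.
  by apply: contraTneq zw => ->; rewrite adj_irrefl.
have [->|lt_i'] := eqVneq i n; first by [].
(* A return to [g i] would give [A] a second neighbour in [T] if [i = 0], and otherwise give [g i] a
   third. *)
apply/eqP => wE; have lt_in : i < n by clear -le_i lt_i lt_i'; lia.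
have adj1 : adj (g i) (g i.+1) by apply: gadj; clear -lt_in; lia.
have adj2 : adj (g i) (g n.+1) by rewrite adj_sym -wE.
have giT k : k <= n.+1 -> g k \in T by exact: gT.
have neq j k : j <= n.+1 -> k <= n.+1 -> j != k -> g j != g k.
  by move=> lj lk; apply: contraNneq => /ginj ->.
case: i => [|i] in le_i lt_i lt_i' wE lt_in adj1 adj2.
  have : 2 <= nbr_count T A.
    rewrite g0 in adj1 adj2; apply: nbr_count_ge2 adj1 adj2 _ _ _.
    - by apply: neq; clear -lt_in; lia.
    - exact: giT.
    - exact: giT.
  by rewrite degA.
have adj0 : adj (g i.+1) (g i) by rewrite adj_sym gadj //; clear -lt_in; lia.
have n1 : g i != g i.+2 by apply: neq; clear -lt_in; lia.
have n2 : g i != g n.+1 by apply: neq; clear -lt_in; lia.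
have n3 : g i.+2 != g n.+1 by apply: neq; clear -lt_in; lia.
have le2 : nbr_count T (g i.+1) <= 2.
  by apply: degT_le2; apply: giT; clear -lt_in; lia.
have := nbr_sum_ge3 (fun x => nat_of_bool (x \in T)) adj0 adj1 adj2 n1 n2 n3.
by rewrite !giT => [/leq_trans/(_ le2)| | |] //; clear -lt_in; lia.
Qed.

(** A path with [#|G|] edges would have too many distinct vertices, so extension stops at [B].
    Further cycles inside [T] are still possible here; connectedness of the graph excludes them
    later. *)
Lemma path_between : exists k g, path_from k g /\ g k = B.
Proof.
suff step n : (exists g, path_from n g) \/ (exists k g, path_from k g /\ g k = B).
  case: (step #|G|) => // -[g [_ _ _ ginj]].
  suff : #|'I_(#|G|).+1| <= #|G| by rewrite card_ord ltnn.
  apply: (@leq_card _ _ (fun i : 'I_(#|G|).+1 => g i)) => i j E.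
  by apply: val_inj; apply: ginj E; rewrite -ltnS.
elim: n => [|n [[g gP]|]]; last by right.
  by left; exists (fun=> A); split=> // i j; rewrite !leqn0 => /eqP -> /eqP ->.
have [gB|gB] := eqVneq (g n) B; first by right; exists n, g.
by left; exact: path_extend gB.
Qed.

End PathBetween.

(** * Reconstruction of the graph from its vertex classes *)

Section ExtremalIsTheta.
Variable G : sgraph.
Hypothesis bicG : bicyclic G.
Variables (A B v0 : G).
Local Notation bare := (@bare G).
Local Notation leaf_bearing := (leaf_bearing G).
Local Notation leaves := (leaves G).
Local Notation p := (nbr_count (bare 1)).
Local Notation a := (nbr_count (bare 2)).
Local Notation m := (nbr_count leaf_bearing).
Hypotheses (A_neq_B : A != B) (bare2E : bare 2 = [set A; B]).
Hypothesis classes : forall v,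
  [|| v \in leaves, v \in bare 1, v \in bare 2 | v \in leaf_bearing].
Hypothesis bare1P : forall v, v \in bare 1 -> a v = 2 /\ p v = 0.
Hypothesis bare2P : forall v, v \in bare 2 -> p v = 2 /\ a v + m v = 1.
Hypothesis leaf_bearingP : forall v, v \in leaf_bearing -> deg v = 3 /\ a v + m v = 2.
Hypothesis v0_lb : v0 \in leaf_bearing.

Let T := bare 2 :|: leaf_bearing.

Lemma nbr_count_T v : nbr_count T v = a v + m v.
Proof.
rewrite -nbr_sumD; apply: nbr_sum_eq => u _; rewrite inE.
by rewrite in_bare; case: (u \in leaf_bearing); rewrite ?andbF ?orbT ?orbF ?addn0.
Qed.

Lemma A_bare2 : A \in bare 2. Proof. by rewrite bare2E !inE eqxx. Qed.
Lemma B_bare2 : B \in bare 2. Proof. by rewrite bare2E !inE eqxx orbT. Qed.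

Lemma bare1_adj v : v \in bare 1 -> adj A v /\ adj B v.
Proof.
move=> vb; have [av _] := bare1P vb.
have : a v <= adj v A + adj v B.
  rewrite -!nbr_sum_eq1 -nbr_sumD; apply: nbr_sum_leq => u _.
  by rewrite bare2E in_set2; do 2 case: eqP.
by rewrite av ![adj v _]adj_sym; do 2 case: adj.
Qed.

Lemma inT_leaf_bearing v : v \in T -> v != A -> v != B -> v \in leaf_bearing.
Proof.
by move=> + /negPf vA /negPf vB; rewrite in_setU bare2E in_set2 vA vB.
Qed.

Lemma degT2 v : v \in T -> v != A -> v != B -> nbr_count T v = 2.
Proof.
move=> vT vA vB; rewrite nbr_count_T.
by have [] := leaf_bearingP (inT_leaf_bearing vT vA vB).
Qed.

Lemma degT_A : nbr_count T A = 1.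
Proof. by rewrite nbr_count_T; have [] := bare2P A_bare2. Qed.

Lemma degT_B : nbr_count T B = 1.
Proof. by rewrite nbr_count_T; have [] := bare2P B_bare2. Qed.

Lemma bare2_inT v : v \in bare 2 -> v \in T.
Proof. by rewrite in_setU => ->. Qed.

(** Otherwise [A] and [B] would be each other's only neighbours in [T], and [bare 1] with [bare 2]
    would exhaust the core, against [v0]. This yields [k >= 2]. *)
Lemma not_adj_AB : ~~ adj A B.
Proof.
apply/negP => AB; have BA : adj B A by rewrite adj_sym.
have [AC _ _ _] := bareE bicG A_bare2.
have : v0 \in bare 1 :|: bare 2; last first.
  by rewrite inE !in_bare v0_lb !andbF.
apply: (core_connected bicG AC).
- by rewrite inE A_bare2 orbT.
- move=> x y xC xW yC xy; have : m x = 0.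
    move: xW; rewrite in_setU => /orP [xb|xb].
      have [ax _] := bare1P xb; have [_ _ ex _] := bareE bicG xb.
      have : nbr_count T x <= deg x.
        by rewrite degE; apply: nbr_sum_leq => u _; case: (u \in T).
      by rewrite nbr_count_T ax deg_excess // ex; lia.
    have [_ am] := bare2P xb; suff : 0 < a x by lia.
    have /set2P [->|->] : x \in [set A; B] by rewrite -bare2E.
      by apply/nbr_countP; exists B => //; exact: B_bare2.
    by apply/nbr_countP; exists A => //; exact: A_bare2.
  move/eqP; rewrite -leqn0 leqNgt => m0.
  have := classes y; case/or4P => [yl|yb|yb|y_lb]; rewrite in_setU ?yb ?orbT //.
    by move: yC; rewrite inE yl.
  by case/negP: m0; apply/nbr_countP; exists y.
- exact: leaf_bearing_in_core.
Qed.

Lemma extremal_isomorphic : exists2 k, 2 <= k & isomorphic G (theta_pendant k).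
Proof.
have [k [g [[g0 gT gadj ginj] gk]]] :=
  path_between (bare2_inT A_bare2) A_neq_B degT_A degT_B degT2.
have k2 : 2 <= k.
  case: k gk gadj {gT ginj} => [|[|k]] // gk gadj.
    by have := A_neq_B; rewrite -gk g0 eqxx.
  by have := not_adj_AB; rewrite -gk -g0 gadj.
exists k => //; case: k k2 gk gT gadj ginj => [|[|n]] // _ gk gT gadj ginj.
have glb i : 0 < i < n.+2 -> g i \in leaf_bearing.
  move=> /andP [i_gt0 i_lt]; apply: inT_leaf_bearing.
  - by apply: gT; lia.
  - by apply/eqP; rewrite -g0 => /ginj; lia.
  - by apply/eqP; rewrite -gk => /ginj; lia.
have [q1 [q2 [q1b q2b q12]]] : exists q1 q2,
    [/\ q1 \in bare 1, q2 \in bare 1 & q1 != q2].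
  have [pA _] := bare2P A_bare2.
  have /nbr_countP [q1 q1b Aq1] : 0 < p A by rewrite pA.
  case: (pickP [pred q2 | (q2 \in bare 1) && (q1 != q2)]) => [q2 /andP [q2b q12]|none].
    by exists q1, q2.
  have : p A <= adj A q1.
    rewrite -nbr_sum_eq1; apply: nbr_sum_leq => u _.
    by have := none u; rewrite /= eq_sym; case: (u \in _); case: eqP.
  by rewrite pA Aq1.
(* A chosen leaf at [v]; the default [v] is not reached when [v] is leaf-bearing. *)
pose lf v := odflt v [pick u | (u \in leaves) && adj v u].
have lfP v : v \in leaf_bearing -> lf v \in leaves /\ adj v (lf v).
  rewrite inE => /andP [_ /nbr_countP [u ul vu]]; rewrite /lf.
  by case: pickP => [w /andP []|/(_ u)] //=; rewrite ul vu.
(* The map goes from the model into [G], so surjectivity, including that the path covers [T], comes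
   from [hom_deg_isomorphic]. *)
pose h (x : theta_pendant n.+2) : G := match x with
  | inl (inl i) => g i
  | inl (inr c) => if c then q2 else q1
  | inr j => lf (g j.+1)
  end.
have lbj (j : 'I_n.+1) : g j.+1 \in leaf_bearing.
  by apply: glb; have := ltn_ord j; lia.
have hT i : i <= n.+2 -> g i \in core G.
  move/gT; rewrite inE => /orP [/(bareE bicG) [] //|].
  exact: leaf_bearing_in_core.
have le_ord (i : 'I_n.+3) : i <= n.+2 by rewrite -ltnS.
have q_b c : (if c then q2 else q1) \in bare 1 by case: c.
have T_bare1 v : v \in T -> v \in bare 1 -> False.
  rewrite inE => /orP [vb|v_lb].
    by rewrite (bare_neq bicG _ vb).
  by rewrite in_bare v_lb andbF.
have core_leaf v : v \in core G -> v \in leaves -> False.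
  by rewrite inE => /negP.
have homarc x y : theta_arc x y -> adj (h x) (h y).
  case: x => [[i|c]|j]; case: y => [[i'|c']|j'] //=.
  - by move=> /eqP E; rewrite -E; apply: gadj; have := ltn_ord i'; lia.
  - have [qA qB] := bare1_adj (q_b c').
    by case/orP => /eqP ->; rewrite ?g0 ?gk.
  - by move=> /eqP ->; have [] := lfP _ (lbj j').
apply: (@hom_deg_isomorphic _ _ h (inl (inr true)) bicG.1).
- move=> [[i|c]|j] [[i'|c']|j'] /=.
  + by move=> /ginj E; congr (inl (inl _)); apply: val_inj; apply: E.
  + by move=> E; case: (@T_bare1 (g i)); [exact: gT|rewrite E].
  + move=> E; case: (@core_leaf (g i)); first exact: hT.
    by rewrite E; have [] := lfP _ (lbj j').
  + by move=> E; case: (@T_bare1 (g i')); [exact: gT|rewrite -E].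
  + case: c; case: c' => // E; by rewrite E eqxx in q12.
  + move=> E; case: (@core_leaf (if c then q2 else q1)).
      by have [] := bareE bicG (q_b c).
    by rewrite E; have [] := lfP _ (lbj j').
  + move=> E; case: (@core_leaf (g i')); first exact: hT.
    by rewrite -E; have [] := lfP _ (lbj j).
  + move=> E; case: (@core_leaf (if c' then q2 else q1)).
      by have [] := bareE bicG (q_b c').
    by rewrite -E; have [] := lfP _ (lbj j).
  + move=> E; have [jl jadj] := lfP _ (lbj j); have [_ jadj'] := lfP _ (lbj j').
    rewrite adj_sym in jadj; rewrite adj_sym -E in jadj'.
    have le_j (k : 'I_n.+1) : k.+1 <= n.+2 by rewrite ltnS ltnW.
    have [jj'] := ginj _ _ (le_j j) (le_j j') (leaf_nbr_uniq jl jadj jadj').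
    by congr inr; apply: val_inj.
- move=> x y /orP [/homarc //|/homarc]; by rewrite adj_sym.
- move=> x; rewrite theta_deg; case: x => [[i|c]|j] /=.
  + have /gT := le_ord i.
    rewrite inE => /orP [/(bareE bicG) [_ _ E _]|/leaf_bearingP [] //].
    by rewrite deg_excess // E.
  + by have [_ _ E _] := bareE bicG (q_b c); rewrite deg_excess // E.
  + by have [+ _] := lfP _ (lbj j); rewrite inE => /eqP.
Qed.

End ExtremalIsTheta.

(** * Existence of a leaf and the equivalence *)

Lemma min_deg_attained (G : sgraph) :
  min_deg G = #|G| \/ exists v : G, deg v = min_deg G.
Proof.
rewrite /min_deg; apply: (big_ind (fun k => k = #|G| \/ exists v : G, deg v = k)).
- by left.
- by move=> k1 k2 H1 H2; rewrite /minn; case: ifP.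
- by move=> v _; right; exists v.
Qed.

(** If the minimum were only the default value [#|G|], the graph would be a single vertex of degree
    0, against the degree sum. *)
Lemma bicyclic_leaf (G : sgraph) : bicyclic G -> min_deg G = 1 ->
  exists v : G, deg v = 1.
Proof.
move=> bicG min1; case: (min_deg_attained G) => [|[v vmin]]; last by exists v; rewrite vmin.
rewrite min1 => cardG; have := bicyclic_sum_deg bicG.
rewrite big1 => [|v _]; first by lia.
apply/eqP; rewrite cards_eq0; apply/eqP/setP => u; rewrite !inE.
have /fintype_le1P/(_ v u) -> : #|G| <= 1 by rewrite -cardG.
exact: adj_irrefl.
Qed.

Theorem theorem1 (R : rcfType) (G : sgraph) (hG : bicyclic G)
    (hdelta : min_deg G = 1) :
  exactly_two_main_signless_eigenvalues R G <->
  exists2 k : nat, 2 <= k & isomorphic G (theta_pendant k).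
Proof.
split=> [two_main|[[|[|n]] // _ [f bij_f adjf]]].
  have [l l1] := bicyclic_leaf hG hdelta.
  have [a [b degR]] := two_main_degree_sum two_main.
  have [c [e [e_gt0 eqn]]] := excess_equation hG l1 degR.
  have [A [B [AB bare2E classes P1 [P2 P3]]]] := extremal_structure hG l1 e_gt0 eqn.
  have [v0 v0_lb] := leaf_bearing_ex hG l1.
  exact: extremal_isomorphic AB bare2E classes P1 P2 P3 v0_lb.
have degf v : deg (f v) = deg v.
  by rewrite !degE (isomorphic_nbr_sum _ bij_f adjf).
have [g fK gK] := bij_f.
(* A path vertex of degree 3 and a pendant vertex witness that the graph is not regular; [k >= 2]
   ensures that a pendant vertex exists. *)
apply: (@six_degree_two_main R G (g (theta_path n 0)) (g (theta_leaf n 0))).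
  by rewrite -!degf !gK !theta_deg.
move=> v; have := theta_six_degree (f v).
rewrite (isomorphic_nbr_sum _ bij_f adjf) degf.
by rewrite (nbr_sum_eq (g := @deg G)) // => u _; exact: degf.
Qed.
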